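(* For $i\in\{1,2,3\}$ let $O_i$ be the connected component of $(0,1/2)^3\setminus\Omega$ containing the point $P_i$, where $P_1=(1/6,1/6,1/6)$, $P_2=(7/15,7/15,7/15)$, $P_3=(1/6,1/4,1/3)$, and $\Omega=\{(a_1,a_2,a_3)\in\mathbb{R}^3 : Q(a_1,a_2,a_3)=0\}$ with $Q$ the polynomial given in the context. Let $(a_1,a_2,a_3)\in O_i$. Then the singular points (in $x_1>0$, $x_2>0$) of the planar system $$\frac{dx_1}{dt}=\widetilde f(x_1,x_2),\qquad \frac{dx_2}{dt}=\widetilde g(x_1,x_2)$$ with parameters $a_1,a_2,a_3$ are as follows: 1) If $i=1$ or $i=2$, then there is one singular point with $\delta>0$ (a node) and three singular points with $\delta<0$ (saddles); 2) If $i=3$, then there are two singular points with $\delta<0$ (saddles).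
   Context: For real parameters $a_1,a_2,a_3$ with $a_1a_2+a_1a_3+a_2a_3\ne 0$ and $a_1a_2a_3\neq 0$, and for $x_1,x_2,x_3>0$, define $$f=-1-a_1x_1\left(\frac{x_1}{x_2x_3}-\frac{x_2}{x_1x_3}-\frac{x_3}{x_1x_2}\right)+x_1B,$$ $$g=-1-a_2x_2\left(\frac{x_2}{x_1x_3}-\frac{x_3}{x_1x_2}-\frac{x_1}{x_2x_3}\right)+x_2B,$$ $$B=\left(\frac{1}{a_1x_1}+\frac{1}{a_2x_2}+\frac{1}{a_3x_3}-\left(\frac{x_1}{x_2x_3}+\frac{x_2}{x_1x_3}+\frac{x_3}{x_1x_2}\right)\right)\left(\frac1{a_1}+\frac1{a_2}+\frac1{a_3}\right)^{-1}.$$ Let $\varphi(x_1,x_2)=x_1^{-a_3/a_1}x_2^{-a_3/a_2}$, $\widetilde f(x_1,x_2)=f(x_1,x_2,\varphi(x_1,x_2))$ and $\widetilde g(x_1,x_2)=g(x_1,x_2,\varphi(x_1,x_2))$ for $x_1,x_2>0$. (This is the normalized Ricci flow of invariant metrics on generalized Wallach spaces restricted to the surface $x_1^{1/a_1}x_2^{1/a_2}x_3^{1/a_3}=1$.) A singular point is a point $(x_1^0,x_2^0)$ with $x_1^0,x_2^0>0$ and $\widetilde f(x_1^0,x_2^0)=\widetilde g(x_1^0,x_2^0)=0$. For a singular point, $J$ denotes the Jacobian matrix of $(\widetilde f,\widetilde g)$ at it, and $\delta=\det J$. A singular point is degenerate if $\delta=0$. A singular point is a saddle if the eigenvalues of $J$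 are real and of opposite signs, and a node if they are real, nonzero and of the same sign. With $s_1=a_1+a_2+a_3$, $s_2=a_1a_2+a_1a_3+a_2a_3$, $s_3=a_1a_2a_3$, the polynomial $Q$ is $$\begin{aligned}Q(a_1,a_2,a_3)={}&(2s_1+4s_3-1)\bigl(64s_1^5-64s_1^4+8s_1^3+12s_1^2-6s_1+1+240s_3s_1^2-240s_3s_1-1536s_3^2s_1\\&\qquad-4096s_3^3+60s_3+768s_3^2\bigr)\\&-8s_1(2s_1+4s_3-1)(2s_1-32s_3-1)(10s_1+32s_3-5)s_2\\&-16s_1^2(13-52s_1+640s_3s_1+1024s_3^2-320s_3+52s_1^2)s_2^2\\&+64(2s_1-1)(2s_1-32s_3-1)s_2^3+2048s_1(2s_1-1)s_2^4.\end{aligned}$$ The surface $\Omega=\{Q=0\}$ is what the paper identifies with the set of parameters for which the planar system has at least one degenerate singular point. *)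

(* Defs.v *)
From mathcomp Require Import all_boot all_order all_algebra.
From mathcomp Require Import all_classical all_reals all_analysis.
From mathcomp Require Import complex.

Set Implicit Arguments.
Unset Strict Implicit.
Unset Printing Implicit Defensive.

Import Order.TTheory GRing.Theory Num.Theory.
Import numFieldNormedType.Exports.

Local Open Scope classical_set_scope.
Local Open Scope ring_scope.

(* Coordinates of row vectors are numbered from 0,
   so (x_1, x_2) is (p 0 0, p 0 1) and (a_1, a_2, a_3) is (a 0 0, a 0 1, a 0 2). *)

Section Defs.
Context {R : realType}.
Implicit Types a x : R.

Definition vec2 x1 x2 : 'rV[R]_2 := \row_(i < 2) [:: x1; x2]`_i.

Definition vec3 x1 x2 x3 : 'rV[R]_3 := \row_(i < 3) [:: x1; x2; x3]`_i.

Definition Qpoly a1 a2 a3 : R :=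
  let s1 := a1 + a2 + a3 in
  let s2 := a1 * a2 + a1 * a3 + a2 * a3 in
  let s3 := a1 * a2 * a3 in
  (2 * s1 + 4 * s3 - 1) *
    (64 * s1 ^+ 5 - 64 * s1 ^+ 4 + 8 * s1 ^+ 3 + 12 * s1 ^+ 2 - 6 * s1 + 1
     + 240 * s3 * s1 ^+ 2 - 240 * s3 * s1 - 1536 * s3 ^+ 2 * s1
     - 4096 * s3 ^+ 3 + 60 * s3 + 768 * s3 ^+ 2)
  - 8 * s1 * (2 * s1 + 4 * s3 - 1) * (2 * s1 - 32 * s3 - 1)
      * (10 * s1 + 32 * s3 - 5) * s2
  - 16 * s1 ^+ 2
      * (13 - 52 * s1 + 640 * s3 * s1 + 1024 * s3 ^+ 2 - 320 * s3
         + 52 * s1 ^+ 2) * s2 ^+ 2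
  + 64 * (2 * s1 - 1) * (2 * s1 - 32 * s3 - 1) * s2 ^+ 3
  + 2048 * s1 * (2 * s1 - 1) * s2 ^+ 4.

Definition Omega : set 'rV[R]_3 :=
  [set a : 'rV[R]_3 | Qpoly (a 0 0) (a 0 1) (a 0 2) = 0].

Definition open_cube : set 'rV[R]_3 :=
  [set a : 'rV[R]_3 | forall i, 0 < a 0 i < 1 / 2].

Definition P1 : 'rV[R]_3 := vec3 (1 / 6) (1 / 6) (1 / 6).
Definition P2 : 'rV[R]_3 := vec3 (7 / 15) (7 / 15) (7 / 15).
Definition P3 : 'rV[R]_3 := vec3 (1 / 6) (1 / 4) (1 / 3).

Definition O1 : set 'rV[R]_3 := connected_component (open_cube `\` Omega) P1.
Definition O2 : set 'rV[R]_3 := connected_component (open_cube `\` Omega) P2.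
Definition O3 : set 'rV[R]_3 := connected_component (open_cube `\` Omega) P3.

Definition B a1 a2 a3 x1 x2 x3 : R :=
  ((a1 * x1)^-1 + (a2 * x2)^-1 + (a3 * x3)^-1
   - (x1 / (x2 * x3) + x2 / (x1 * x3) + x3 / (x1 * x2)))
  * (a1^-1 + a2^-1 + a3^-1)^-1.

Definition f a1 a2 a3 x1 x2 x3 : R :=
  - 1 - a1 * x1 * (x1 / (x2 * x3) - x2 / (x1 * x3) - x3 / (x1 * x2))
  + x1 * B a1 a2 a3 x1 x2 x3.

Definition g a1 a2 a3 x1 x2 x3 : R :=
  - 1 - a2 * x2 * (x2 / (x1 * x3) - x3 / (x1 * x2) - x1 / (x2 * x3))
  + x2 * B a1 a2 a3 x1 x2 x3.

Definition phi a1 a2 a3 x1 x2 : R :=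
  x1 `^ (- (a3 / a1)) * x2 `^ (- (a3 / a2)).

Definition ftilde a1 a2 a3 x1 x2 : R := f a1 a2 a3 x1 x2 (phi a1 a2 a3 x1 x2).

Definition gtilde a1 a2 a3 x1 x2 : R := g a1 a2 a3 x1 x2 (phi a1 a2 a3 x1 x2).

(* Only its values on the open quadrant x_1, x_2 > 0 are meaningful; the
   Jacobian is taken only at points of that open set. *)
Definition field a1 a2 a3 (p : 'rV[R]_2) : 'rV[R]_2 :=
  vec2 (ftilde a1 a2 a3 (p 0 0) (p 0 1)) (gtilde a1 a2 a3 (p 0 0) (p 0 1)).

Definition singular_point a1 a2 a3 : set 'rV[R]_2 :=
  [set p : 'rV[R]_2 | [/\ 0 < p 0 0, 0 < p 0 1,
    ftilde a1 a2 a3 (p 0 0) (p 0 1) = 0 & gtilde a1 a2 a3 (p 0 0) (p 0 1) = 0]].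

(* [jacobian] acts on row vectors, hence the transpose: row i of J holds the
   partial derivatives of the i-th component. *)
Definition J a1 a2 a3 (p : 'rV[R]_2) : 'M[R]_2 :=
  (jacobian (field a1 a2 a3) p)^T.

Definition delta a1 a2 a3 (p : 'rV[R]_2) : R := \det (J a1 a2 a3 p).

(* [eigenvalue] only sees eigenvalues in the ground field, so A is viewed over
   the complex numbers R[i]: its complex eigenvalues are exactly the real
   numbers l and m (l = m is allowed). *)
Definition real_eigenvalues (A : 'M[R]_2) (l m : R) : Prop :=
  forall z : R[i],
    eigenvalue (map_mx (real_complex R) A) z <-> z = l%:C%C \/ z = m%:C%C.

Definition saddle a1 a2 a3 (p : 'rV[R]_2) : Prop :=
  singular_point a1 a2 a3 p /\
  exists l m : R, real_eigenvalues (J a1 a2 a3 p) l m /\ l < 0 < m.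

Definition node a1 a2 a3 (p : 'rV[R]_2) : Prop :=
  singular_point a1 a2 a3 p /\
  exists l m : R, real_eigenvalues (J a1 a2 a3 p) l m /\
    ((0 < l /\ 0 < m) \/ (l < 0 /\ m < 0)).

Definition one_node_three_saddles a1 a2 a3 : Prop :=
  exists p q1 q2 q3 : 'rV[R]_2,
    [/\ uniq [:: p; q1; q2; q3],
        singular_point a1 a2 a3 = [set` [:: p; q1; q2; q3]],
        0 < delta a1 a2 a3 p /\ node a1 a2 a3 p
      & forall q, q \in [:: q1; q2; q3] ->
          delta a1 a2 a3 q < 0 /\ saddle a1 a2 a3 q].

Definition two_saddles a1 a2 a3 : Prop :=
  exists q1 q2 : 'rV[R]_2,
    [/\ uniq [:: q1; q2],
        singular_point a1 a2 a3 = [set` [:: q1; q2]]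
      & forall q, q \in [:: q1; q2] ->
          delta a1 a2 a3 q < 0 /\ saddle a1 a2 a3 q].

End Defs.

(* Main.v *)
Require Import Defs.
From mathcomp Require Import all_boot all_order all_algebra.
From mathcomp Require Import all_classical all_reals all_analysis.
From mathcomp Require Import complex ring lra.

(** The type and number of singular points depend only on the sign of Q on the
whole cube (0,1/2)^3: four points when Q < 0, two when Q > 0. Since Q is
continuous and does not vanish on the cube minus Omega, its sign is constant on
each component [component_Qpoly_sign]; it is negative at P_1 and P_2 and
positive at P_3.

Reduction to two conics. Put q_i = x_j x_k + a_i (x_i^2 - x_j^2 - x_k^2); up to
the factor 2 x_1 x_2 x_3 this is the principal Ricci curvature r_i. Then f = (m
- q_1) / (x_2 x_3) and g = (m - q_2) / (x_1 x_3), where m is the mean of q_1,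
q_2, q_3 with weights proportional to 1/a_i, so singular points are solutions of
q_1 = q_2 = q_3. These equations are homogeneous, and the surface x_3 = phi(x_1,
x_2) meets every ray of the positive octant exactly once, so it is enough to
solve them up to scaling [singular_ratios, of_ratiosK, ratiosK]. On the cube a
real solution has all coordinates of the same sign [ric_form_same_sign,
ric_form_coord_neq0]: positivity comes for free, and counting singular points is
counting the real common points of two conics.

Counting. With u = (x_2 + x_3) / x_1, v = (x_3 - x_2) / x_1, s = a_2 + a_3 and d
= a_2 - a_3, the conic q_2 = q_3 is v (1 - s u) = d. If d is nonzero,
eliminating v leaves a quartic in u whose discriminant is - s^4 d^2 Q / 4
[elim_disc_Qpoly]. The quartic is positive at 0, negative at 1/s and positive
for large u, so it always has two real roots; the sign of the discriminant then
decides whether the complementary quadratic factor has real roots. If d = 0, the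
conic q_2 = q_3 is a pair of lines and all solutions are explicit.

Sign of delta. At a singular point delta is, up to the positive factor 1 / (x_2
x_3), the Jacobian determinant of the two conics in (u, v) [delta_reduced_jac],
and at a root u of the quartic P this determinant is P'(u) / (1 - s u). Since P
is negative at 1/s, of four roots three lie on one side of 1/s and one on the
other; P' alternates in sign along the roots and 1 - s u changes sign at 1/s, so
only the middle one of the three has delta > 0.

Type. The flow is a gradient flow: J is similar to the product of the inverse of
a positive definite symmetric matrix and a symmetric matrix, so its eigenvalues
are real [J_symmetrizable, symmetrizable_disc]. Hence delta > 0 gives a node,
and delta < 0 a saddle. *)

Set Implicit Arguments.
Unset Strict Implicit.
Unset Printing Implicit Defensive.

Import Order.TTheory GRing.Theory Num.Theory.
Import numFieldNormedType.Exports.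

Local Open Scope classical_set_scope.
Local Open Scope ring_scope.

(** * Quartic polynomials over a real closed field *)

Section Quartic.
Variable R : rcfType.
Implicit Types (c u r t : R).

Definition quartic c4 c3 c2 c1 c0 u : R :=
  c4 * u ^+ 4 + c3 * u ^+ 3 + c2 * u ^+ 2 + c1 * u + c0.

Definition dquartic c4 c3 c2 c1 u : R :=
  4 * c4 * u ^+ 3 + 3 * c3 * u ^+ 2 + 2 * c2 * u + c1.

(** The coefficients a, ..., e go from degree 4 down to the constant one. *)
Definition quartic_disc (a b c d e : R) : R :=
  256 * a ^+ 3 * e ^+ 3 - 192 * a ^+ 2 * b * d * e ^+ 2
  - 128 * a ^+ 2 * c ^+ 2 * e ^+ 2 + 144 * a ^+ 2 * c * d ^+ 2 * e
  - 27 * a ^+ 2 * d ^+ 4 + 144 * a * b ^+ 2 * c * e ^+ 2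
  - 6 * a * b ^+ 2 * d ^+ 2 * e - 80 * a * b * c ^+ 2 * d * e
  + 18 * a * b * c * d ^+ 3 + 16 * a * c ^+ 4 * e - 4 * a * c ^+ 3 * d ^+ 2
  - 27 * b ^+ 4 * e ^+ 2 + 18 * b ^+ 3 * c * d * e - 4 * b ^+ 3 * d ^+ 3
  - 4 * b ^+ 2 * c ^+ 3 * e + b ^+ 2 * c ^+ 2 * d ^+ 2.

(** The factorization by (u - r) (u - r') with cofactor c4 u^2 + m u + n is
written on coefficients, so that it can be substituted in the discriminant. *)
Lemma quartic_split c4 c3 c2 c1 c0 r r' :
  r != r' -> quartic c4 c3 c2 c1 c0 r = 0 -> quartic c4 c3 c2 c1 c0 r' = 0 ->
  exists m n, [/\ c3 = m - c4 * (r + r'),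
    c2 = n - m * (r + r') + c4 * r * r',
    c1 = m * r * r' - n * (r + r') & c0 = n * r * r'].
Proof.
rewrite /quartic => rr' Pr Pr'.
exists (c3 + c4 * (r + r')),
  (c2 + c3 * (r + r') + c4 * (r ^+ 2 + r * r' + r' ^+ 2)).
have rr'0 : r - r' != 0 by rewrite subr_eq0.
have e1 : c1 = - c4 * (r ^+ 3 + r ^+ 2 * r' + r * r' ^+ 2 + r' ^+ 3)
    - c3 * (r ^+ 2 + r * r' + r' ^+ 2) - c2 * (r + r').
  apply: (mulfI rr'0); apply/eqP; rewrite -subr_eq0; apply/eqP.
  rewrite -[RHS](subrr (0 : R)) -{1}Pr -Pr'; ring.
have e0 : c0 = - (c4 * r ^+ 4 + c3 * r ^+ 3 + c2 * r ^+ 2 + c1 * r) by lra.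
split; rewrite ?e0 ?e1; ring.
Qed.

(** The discriminant is that of the cofactor times squares: the squared
difference of the known roots and the squared resultant of the two factors. Its
sign is therefore the sign of the discriminant of the cofactor. *)
Lemma quartic_disc_split c4 m n r r' :
  quartic_disc c4 (m - c4 * (r + r')) (n - m * (r + r') + c4 * r * r')
    (m * r * r' - n * (r + r')) (n * r * r') =
  (m ^+ 2 - 4 * c4 * n) *
  ((r - r') * (c4 * r ^+ 2 + m * r + n) * (c4 * r' ^+ 2 + m * r' + n)) ^+ 2.
Proof. rewrite /quartic_disc; ring. Qed.

(** The cofactor has negative discriminant and positive leading coefficient, so
it is positive everywhere; its values at r and r' are the constants k and k'. *)
Lemma quartic_two_real c4 c3 c2 c1 c0 r r' : 0 < c4 -> r != r' ->
  quartic c4 c3 c2 c1 c0 r = 0 -> quartic c4 c3 c2 c1 c0 r' = 0 ->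
  quartic_disc c4 c3 c2 c1 c0 < 0 ->
  (forall u, quartic c4 c3 c2 c1 c0 u = 0 -> u = r \/ u = r') /\
  exists k k', [/\ 0 < k, 0 < k',
    dquartic c4 c3 c2 c1 r = k * (r - r') &
    dquartic c4 c3 c2 c1 r' = k' * (r' - r)].
Proof.
move=> c4_gt0 rr' Pr Pr'.
have [m [n [-> -> -> ->]]] := quartic_split rr' Pr Pr'.
rewrite quartic_disc_split => D.
have {}D : m ^+ 2 - 4 * c4 * n < 0.
  rewrite ltNge; apply/negP => D'; move: D; rewrite ltNge => /negP; apply.
  by rewrite mulr_ge0 // sqr_ge0.
have q_gt0 u : 0 < c4 * u ^+ 2 + m * u + n.
  rewrite -(pmulr_lgt0 (x := 4 * c4)); last lra.
  suff -> : (c4 * u ^+ 2 + m * u + n) * (4 * c4) =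
     (2 * c4 * u + m) ^+ 2 - (m ^+ 2 - 4 * c4 * n).
    by rewrite subr_gt0 (lt_le_trans D) // sqr_ge0.
  ring.
split=> [u|].
  have -> : quartic c4 (m - c4 * (r + r')) (n - m * (r + r') + c4 * r * r')
    (m * r * r' - n * (r + r')) (n * r * r') u =
    (u - r) * (u - r') * (c4 * u ^+ 2 + m * u + n) by rewrite /quartic; ring.
  move=> /eqP; rewrite !mulf_eq0 !subr_eq0 (gt_eqF (q_gt0 u)) orbF.
  by move=> /orP[] /eqP; [left|right].
exists (c4 * r ^+ 2 + m * r + n), (c4 * r' ^+ 2 + m * r' + n).
by split; rewrite // /dquartic; ring.
Qed.

Lemma quartic_four_real c4 c3 c2 c1 c0 r r' : 0 < c4 -> r != r' ->
  quartic c4 c3 c2 c1 c0 r = 0 -> quartic c4 c3 c2 c1 c0 r' = 0 ->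
  0 < quartic_disc c4 c3 c2 c1 c0 ->
  exists t t', [/\ uniq [:: r; r'; t; t'],
    (forall u, quartic c4 c3 c2 c1 c0 u =
       c4 * ((u - r) * (u - r') * (u - t) * (u - t'))) &
    (forall u, dquartic c4 c3 c2 c1 u =
       c4 * ((u - r') * (u - t) * (u - t') + (u - r) * (u - t) * (u - t')
         + (u - r) * (u - r') * (u - t') + (u - r) * (u - r') * (u - t)))].
Proof.
move=> c4_gt0 rr' Pr Pr'.
have [m [n [-> -> -> ->]]] := quartic_split rr' Pr Pr'.
rewrite quartic_disc_split => D.
have D_gt0 : 0 < m ^+ 2 - 4 * c4 * n.
  rewrite ltNge; apply/negP => D'; move: D; rewrite ltNge => /negP; apply.
  by rewrite mulr_le0_ge0 // sqr_ge0.
have qn0 : (c4 * r ^+ 2 + m * r + n) * (c4 * r' ^+ 2 + m * r' + n) != 0.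
  apply: contraTneq D => q0; by rewrite -(mulrA (r - r')) q0 mulr0 expr0n mulr0 ltxx.
pose w := Num.sqrt (m ^+ 2 - 4 * c4 * n).
have w_gt0 : 0 < w by rewrite sqrtr_gt0.
have w2 : w ^+ 2 = m ^+ 2 - 4 * c4 * n by rewrite sqr_sqrtr // ltW.
have c40 : c4 != 0 by rewrite gt_eqF.
pose t := (- m - w) / (2 * c4); pose t' := (- m + w) / (2 * c4).
have em : m = - c4 * (t + t') by rewrite /t /t'; field.
have en : n = c4 * (t * t').
  have -> : c4 * (t * t') = (m ^+ 2 - w ^+ 2) / (4 * c4) by rewrite /t /t'; field.
  by rewrite w2; field.
exists t, t'; split.
- have tt' : t != t'.
    rewrite -subr_eq0 (_ : t - t' = - (w / c4)) ?oppr_eq0; last first.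
      by rewrite /t /t'; field.
    by rewrite mulf_neq0 ?invr_neq0 // gt_eqF.
  have q_fact u : c4 * u ^+ 2 + m * u + n = c4 * ((u - t) * (u - t')).
    rewrite em en; ring.
  move: qn0; rewrite !q_fact !mulf_eq0 !negb_or !subr_eq0.
  move=> /andP[/and3P[_ rt rt'] /and3P[_ r't r't']].
  by rewrite /= !inE !negb_or rr' rt rt' r't r't' tt'.
- by move=> u; rewrite em en /quartic; ring.
- by move=> u; rewrite em en /dquartic; ring.
Qed.

Lemma quartic_horner (c4 c3 c2 c1 c0 : R) :
  exists p : {poly R}, forall u : R, p.[u] = quartic c4 c3 c2 c1 c0 u.
Proof.
exists (c4 *: 'X^4 + c3 *: 'X^3 + c2 *: 'X^2 + c1 *: 'X + c0%:P) => u.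
by rewrite /quartic !hornerE.
Qed.

(** M is a Cauchy bound: since M >= 1, the terms of degree at most 3 are
together at least - S M^3. *)
Lemma quartic_pos_above (c4 c3 c2 c1 c0 t : R) : 0 < c4 ->
  exists2 M, t < M & 0 < quartic c4 c3 c2 c1 c0 M.
Proof.
move=> c4_gt0; pose S := `|c3| + `|c2| + `|c1| + `|c0|.
pose M := 1 + `|t| + S / c4.
have S_ge0 : 0 <= S by rewrite /S !addr_ge0.
have Sc : 0 <= S / c4 by rewrite divr_ge0 // ltW.
have M1 : 1 <= M by rewrite /M; have := normr_ge0 t; lra.
have cM : S < c4 * M.
  have -> : c4 * M = c4 * (1 + `|t|) + S by rewrite /M; field; rewrite gt_eqF.
  by rewrite ltrDr mulr_gt0 // ltr_pwDl.
exists M; first by rewrite /M; have := ler_norm t; lra.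
have bnd c k : (k <= 3)%N -> - `|c| * M ^+ 3 <= c * M ^+ k.
  move=> k3; have Mk : M ^+ k <= M ^+ 3 by rewrite ler_weXn2l.
  have Mk0 : 0 <= M ^+ k by rewrite exprn_ge0 //; lra.
  apply: (@le_trans _ _ (- `|c| * M ^+ k)).
    by rewrite !mulNr lerN2 ler_wpM2l.
  by rewrite ler_wpM2r // lerNl -normrN ler_norm.
have M3 : 0 < M ^+ 3 by rewrite exprn_gt0 //; lra.
have : 0 < (c4 * M - S) * M ^+ 3 by rewrite mulr_gt0 // subr_gt0.
have := bnd c3 3%N isT; have := bnd c2 2%N isT; have := bnd c1 1%N isT.
have := bnd c0 0%N isT; rewrite /quartic /S expr1 expr0 mulr1.
have -> : c4 * M ^+ 4 = c4 * M * M ^+ 3 by ring.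
lra.
Qed.

Lemma quartic_two_roots (c4 c3 c2 c1 c0 t : R) : 0 < c4 -> 0 < t ->
  0 < quartic c4 c3 c2 c1 c0 0 -> quartic c4 c3 c2 c1 c0 t < 0 ->
  exists r r', [/\ r < t, t < r', quartic c4 c3 c2 c1 c0 r = 0 &
    quartic c4 c3 c2 c1 c0 r' = 0].
Proof.
move=> c4_gt0 t_gt0 P0 Pt; have [p pE] := quartic_horner c4 c3 c2 c1 c0.
have [M tM PM] := quartic_pos_above c3 c2 c1 c0 t c4_gt0.
have [|r /andP[_ rt]] := @poly_ivt _ (- p) 0 t (ltW t_gt0).
  by rewrite !hornerE !pE ltW ?oppr_lt0 // ltW // oppr_gt0.
rewrite rootE !hornerE pE oppr_eq0 => /eqP Pr.
have [|r' /andP[tr' _]] := @poly_ivt _ p t M (ltW tM); first by rewrite !pE !ltW.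
rewrite rootE pE => /eqP Pr'.
exists r, r'; split=> //.
  by rewrite lt_neqAle rt andbT; apply: contraTneq (Pt) => <-; rewrite Pr ltxx.
by rewrite lt_neqAle tr' andbT; apply: contraTneq (Pt) => ->; rewrite Pr' ltxx.
Qed.

(** The relation T stands for a property of the unordered triple, such as being
the set of three of the roots; it lets the sign discussion assume an order. *)
Lemma sort3 (T : R -> R -> R -> Prop) x y z :
  (forall x y z, T x y z -> T y x z) -> (forall x y z, T x y z -> T x z y) ->
  x != y -> x != z -> y < z -> T x y z ->
  exists r1 r2 r3, [/\ r1 < r2, r2 < r3 & T r1 r2 r3].
Proof.
move=> T12 T23 xy xz yz Txyz; case: (ltgtP x y) xy => // xy _.
  by exists x, y, z.
case: (ltgtP x z) xz => // xz _; first by exists y, x, z; split=> //; apply: T12.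
by exists y, z, x; split=> //; apply/T23/T12.
Qed.

(** The derivative is recorded together with the factorization, so that P'(x)
can be read off at each root without differentiating. *)
Definition roots4 c4 (P dP : R -> R) x y z w : Prop :=
  (forall u, P u = c4 * ((u - x) * (u - y) * (u - z) * (u - w))) /\
  (forall u, dP u = c4 * ((u - y) * (u - z) * (u - w) + (u - x) * (u - z) * (u - w)
         + (u - x) * (u - y) * (u - w) + (u - x) * (u - y) * (u - z))).

End Quartic.

(** * The reduced system and its elimination quartic *)

Section Elimination.
Variable R : rcfType.
Implicit Types (a s d u v r t c : R).

(** With v = d / (1 - s u), the remaining equation times (1 - s u)^2 is ((1/2 -
a) u^2 - u + 2 a + s) (1 - s u)^2 - d^2 (s u^2 - u + 1/2 + a), and the next five
definitions are its coefficients. *)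
Definition elim_c4 a s : R := (1 / 2 - a) * s ^+ 2.
Definition elim_c3 a s : R := - s ^+ 2 - 2 * (1 / 2 - a) * s.
Definition elim_c2 a s d : R := 1 / 2 - a + 2 * s + s ^+ 2 * (2 * a + s) - d ^+ 2 * s.
Definition elim_c1 a s d : R := - 1 - 2 * s * (2 * a + s) + d ^+ 2.
Definition elim_c0 a s d : R := 2 * a + s - d ^+ 2 * (1 / 2 + a).

Definition elim_quartic a s d : R -> R :=
  quartic (elim_c4 a s) (elim_c3 a s) (elim_c2 a s d) (elim_c1 a s d) (elim_c0 a s d).
Definition elim_dquartic a s d : R -> R :=
  dquartic (elim_c4 a s) (elim_c3 a s) (elim_c2 a s d) (elim_c1 a s d).

(** This is (2 q_1 - q_2 - q_3) / x_1^2 in the coordinates u, v. *)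
Definition reduced_eq a s d u v : R :=
  (u ^+ 2 - v ^+ 2) / 2 + a * (2 - u ^+ 2 - v ^+ 2) - u + s + d * u * v.

(** The first equation is q_2 = q_3, and the pair is (u, v). *)
Definition reduced a s d (z : R * R) : Prop :=
  z.2 * (1 - s * z.1) = d /\ reduced_eq a s d z.1 z.2 = 0.

(** The determinant of the partial derivatives in u and v of the pair
(reduced_eq, v (1 - s u) - d). *)
Definition reduced_jac a s d (z : R * R) : R :=
  (z.1 - 2 * a * z.1 - 1 + d * z.2) * (1 - s * z.1)
  + (d * z.1 - z.2 - 2 * a * z.2) * (s * z.2).

Lemma elim_quarticE a s d u v : v * (1 - s * u) = d ->
  elim_quartic a s d u = (1 - s * u) ^+ 2 * reduced_eq a s d u v.
Proof.
by move=> <-; rewrite /elim_quartic /quartic /elim_c4 /elim_c3 /elim_c2 /elim_c1 /elim_c0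
  /reduced_eq; field.
Qed.

(** Along the curve v (1 - s u) = d, implicit differentiation turns the Jacobian
determinant into (1 - s u) times the derivative of reduced_eq; the second
summand comes from differentiating the factor (1 - s u)^2. *)
Lemma elim_dquarticE a s d u v : v * (1 - s * u) = d ->
  elim_dquartic a s d u =
  (1 - s * u) * reduced_jac a s d (u, v) - 2 * s * (1 - s * u) * reduced_eq a s d u v.
Proof.
by move=> <-; rewrite /elim_dquartic /dquartic /elim_c4 /elim_c3 /elim_c2 /elim_c1
  /reduced_eq /reduced_jac /=; field.
Qed.

(** The point u = 1/s is excluded because the quartic is - d^2 (1/2 + a) there.
*)
Lemma reduced_root a s d u v : 0 < a -> d != 0 ->
  reduced a s d (u, v) <-> elim_quartic a s d u = 0 /\ v = d / (1 - s * u).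
Proof.
move=> a_gt0 d0; split=> [[/= e2 e1]|[P0 ->]].
  have t0 : 1 - s * u != 0.
    by apply: contraNneq (d0) => t0; rewrite -e2 t0 mulr0.
  by rewrite (elim_quarticE a e2) e1 mulr0 -e2 mulfK.
have t0 : 1 - s * u != 0.
  apply: contraNneq (d0) => t0; move: P0.
  rewrite (_ : elim_quartic a s d u = (1 - s * u) *
     (((1 / 2 - a) * u ^+ 2 - u + 2 * a + s) * (1 - s * u)) -
     d ^+ 2 * (1 / 2 + a - u * (1 - s * u))); last first.
    by rewrite /elim_quartic /quartic /elim_c4 /elim_c3 /elim_c2 /elim_c1 /elim_c0; field.
  rewrite t0 mul0r mulr0 sub0r subr0 => /eqP.
  by rewrite oppr_eq0 mulf_eq0 expf_eq0 (negPf d0) /= => /eqP; lra.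
have e2 : d / (1 - s * u) * (1 - s * u) = d by rewrite divfK.
split=> //=; move: P0; rewrite (elim_quarticE a e2) => /eqP.
by rewrite mulf_eq0 expf_eq0 (negPf t0) /= => /eqP.
Qed.

(** The values of the quartic are 2 a + s - d^2 (1/2 + a) > 0 at 0 and - d^2
(1/2 + a) < 0 at 1/s, and its leading coefficient is positive. *)
Lemma elim_two_roots a s d : 0 < a < 1 / 2 -> 0 < s < 1 ->
  `|d| < s -> `|d| < 1 / 2 -> d != 0 ->
  exists r r', [/\ r < s^-1, s^-1 < r', elim_quartic a s d r = 0 &
    elim_quartic a s d r' = 0].
Proof.
move=> /andP[a0 a1] /andP[s0 s1]; rewrite !ltr_norml => /andP[? ?] /andP[? ?] d0.
apply: quartic_two_roots.
- by rewrite /elim_c4 mulr_gt0 ?exprn_gt0 //; lra.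
- by rewrite invr_gt0.
- rewrite /quartic /elim_c0 !expr0n /= !mulr0 !add0r.
  have : d ^+ 2 * (1 / 2 + a) <= d ^+ 2 by rewrite ler_piMr ?sqr_ge0 //; lra.
  have : d ^+ 2 < s; last by lra.
  by nra.
- have -> : quartic (elim_c4 a s) (elim_c3 a s) (elim_c2 a s d) (elim_c1 a s d) (elim_c0
  a s d) s^-1 =
    - (d ^+ 2 * (1 / 2 + a)).
    by rewrite /quartic /elim_c4 /elim_c3 /elim_c2 /elim_c1 /elim_c0; field;
      rewrite gt_eqF.
  by rewrite oppr_lt0 mulr_gt0 ?exprn_even_gt0 //=; lra.
Qed.

Definition one_pos_three_neg (S : R * R -> Prop) (k : R * R -> R) :=
  exists z0 z1 z2 z3, [/\ uniq [:: z0; z1; z2; z3],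
    (forall z, S z <-> z \in [:: z0; z1; z2; z3]),
    0 < k z0 & forall z, z \in [:: z1; z2; z3] -> k z < 0].

Definition two_neg (S : R * R -> Prop) (k : R * R -> R) :=
  exists z1 z2, [/\ uniq [:: z1; z2],
    (forall z, S z <-> z \in [:: z1; z2]) &
    forall z, z \in [:: z1; z2] -> k z < 0].

Lemma sg_subr_lt (x y : R) : x < y -> Num.sg (x - y) = -1.
Proof. by rewrite -subr_lt0 => /ltr0_sg. Qed.
Lemma sg_subr_gt (x y : R) : x < y -> Num.sg (y - x) = 1.
Proof. by rewrite -subr_gt0 => /gtr0_sg. Qed.

(** At a root, [elim_dquarticE] says that P'(u) = (1 - s u) D, where D is the
Jacobian determinant; and 1 - s u has the sign of 1/s - u. *)
Lemma sg_reduced_jac a s d u : 0 < s -> u != s^-1 -> elim_quartic a s d u = 0 ->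
  Num.sg (reduced_jac a s d (u, d / (1 - s * u))) =
  Num.sg (elim_dquartic a s d u) * Num.sg (s^-1 - u).
Proof.
move=> s0 us; have sn0 : s != 0 by rewrite gt_eqF.
have eu : 1 - s * u = s * (s^-1 - u) by field.
have t0 : 1 - s * u != 0 by rewrite eu mulf_neq0 // subr_eq0 eq_sym.
have e2 : d / (1 - s * u) * (1 - s * u) = d by rewrite divfK.
rewrite (elim_quarticE a e2) => /eqP.
rewrite mulf_eq0 expf_eq0 (negPf t0) /= => /eqP e1.
rewrite (elim_dquarticE a e2) e1 mulr0 subr0; set k := reduced_jac _ _ _ _.
rewrite eu !sgrM (gtr0_sg s0) mul1r mulrAC -expr2 sqr_sg subr_eq0 eq_sym us.
by rewrite mul1r.
Qed.

(** The middle root r2 of the three roots on the same side of 1/s is the node: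
the sign of P' alternates along the roots, and the sign of 1/s - u is the same
at r1, r2, r3 and opposite at r4. *)
Lemma reduced_of_sorted a s d k r1 r2 r3 r4 : 0 < a -> 0 < s -> d != 0 -> 0 < k ->
  r1 < r2 -> r2 < r3 -> (r3 < s^-1 < r4) || (r4 < s^-1 < r1) ->
  roots4 k (elim_quartic a s d) (elim_dquartic a s d) r1 r2 r3 r4 ->
  one_pos_three_neg (reduced a s d) (reduced_jac a s d).
Proof.
move=> a0 s0 d0 k_gt0 r12 r23 r34 [PE dPE].
pose z r : R * R := (r, d / (1 - s * r)).
have z_neq r r' : r != r' -> z r != z r' by apply: contraNneq => -[->].
have P1 : elim_quartic a s d r1 = 0 by rewrite PE; ring.
have P2 : elim_quartic a s d r2 = 0 by rewrite PE; ring.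
have P3 : elim_quartic a s d r3 = 0 by rewrite PE; ring.
have P4 : elim_quartic a s d r4 = 0 by rewrite PE; ring.
have r13 := lt_trans r12 r23.
have d1 : elim_dquartic a s d r1 = k * ((r1 - r2) * (r1 - r3) * (r1 - r4)).
  by rewrite dPE; ring.
have d2 : elim_dquartic a s d r2 = k * ((r2 - r1) * (r2 - r3) * (r2 - r4)).
  by rewrite dPE; ring.
have d3 : elim_dquartic a s d r3 = k * ((r3 - r1) * (r3 - r2) * (r3 - r4)).
  by rewrite dPE; ring.
have d4 : elim_dquartic a s d r4 = k * ((r4 - r1) * (r4 - r2) * (r4 - r3)).
  by rewrite dPE; ring.
have [H1 [H2 [H3 [H4 [n14 [n24 n34]]]]]] :
    reduced_jac a s d (z r1) < 0 /\ 0 < reduced_jac a s d (z r2) /\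
      reduced_jac a s d (z r3) < 0 /\
    reduced_jac a s d (z r4) < 0 /\ r1 != r4 /\ r2 != r4 /\ r3 != r4.
  case/orP: r34 => /andP[h3 h4].
    have t2 := lt_trans r23 h3; have t1 := lt_trans r12 t2.
    have r34 := lt_trans h3 h4; have r24 := lt_trans r23 r34.
    have r14 := lt_trans r12 r24.
    rewrite !lt_eqF // -!sgr_cp0 !sg_reduced_jac ?(lt_eqF t1) ?(lt_eqF t2) ?(lt_eqF h3)
      ?(gt_eqF h4) // d1 d2 d3 d4 !sgrM (gtr0_sg k_gt0).
    rewrite !(sg_subr_lt r12, sg_subr_lt r13, sg_subr_lt r14, sg_subr_lt r23,
      sg_subr_lt r24,
      sg_subr_lt r34, sg_subr_gt r12, sg_subr_gt r13, sg_subr_gt r14, sg_subr_gt r23,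
        sg_subr_gt r24,
      sg_subr_gt r34, sg_subr_gt t1, sg_subr_gt t2, sg_subr_gt h3, sg_subr_lt h4).
    by rewrite !(mulr1, mulrN1, opprK, mul1r) !eqxx.
  have t2 := lt_trans h4 r12; have t3 := lt_trans t2 r23.
  have r14 := lt_trans h3 h4; have r24 := lt_trans r14 r12.
  have r34 := lt_trans r24 r23.
  rewrite !gt_eqF // -!sgr_cp0 !sg_reduced_jac ?(gt_eqF t3) ?(gt_eqF t2) ?(lt_eqF h3)
    ?(gt_eqF h4) // d1 d2 d3 d4 !sgrM (gtr0_sg k_gt0).
  rewrite !(sg_subr_lt r12, sg_subr_lt r13, sg_subr_lt r14, sg_subr_lt r23,
    sg_subr_lt r24,
    sg_subr_lt r34, sg_subr_gt r12, sg_subr_gt r13, sg_subr_gt r14, sg_subr_gt r23,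
      sg_subr_gt r24,
    sg_subr_gt r34, sg_subr_lt t2, sg_subr_lt t3, sg_subr_gt h3, sg_subr_lt h4).
  by rewrite !(mulr1, mulrN1, opprK, mul1r) !eqxx.
exists (z r2), (z r1), (z r3), (z r4); split=> //.
- by rewrite /= !inE !negb_or !z_neq // ?(gt_eqF r12) ?(lt_eqF r23) ?(lt_eqF r13).
- move=> [u v]; rewrite reduced_root // PE; split.
    move=> [/eqP]; rewrite mulf_eq0 (gt_eqF k_gt0) /= !mulf_eq0 !subr_eq0 !inE.
    by move=> /orP[/orP[/orP[]|]|] /eqP -> ->; rewrite /z !eqxx ?orbT.
  by rewrite !inE => /or4P[] /eqP[-> ->]; split=> //; ring.
- by move=> y; rewrite !inE => /or3P[] /eqP ->.
Qed.

(** Two roots r < 1/s < r' are known. The two others lie on the same side of 1/s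
because the quartic is negative there, and so they join r or r' to form the
sorted triple of [reduced_of_sorted]. *)
Lemma reduced_four a s d : 0 < a < 1 / 2 -> 0 < s < 1 ->
  `|d| < s -> `|d| < 1 / 2 -> d != 0 ->
  0 < quartic_disc (elim_c4 a s) (elim_c3 a s) (elim_c2 a s d) (elim_c1 a s d) (elim_c0 a
    s d) ->
  one_pos_three_neg (reduced a s d) (reduced_jac a s d).
Proof.
move=> a01 s01 ds d1 d0 D.
have [r [r' [rt tr' Pr Pr']]] := elim_two_roots a01 s01 ds d1 d0.
have /andP[a_gt0 a_lt] := a01; have /andP[s_gt0 s_lt] := s01.
have k_gt0 : 0 < elim_c4 a s by rewrite /elim_c4 mulr_gt0 ?exprn_gt0 //; lra.
have rr' : r != r' by rewrite lt_eqF // (lt_trans rt).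
have [x [y [Un PE dPE]]] := quartic_four_real k_gt0 rr' Pr Pr' D.
wlog xy : x y Un PE dPE / x < y.
  move=> H; have : x != y.
    by move: Un; rewrite /= !inE => /and4P[].
  case: (ltgtP x y) => // xy _; first exact: (H x y).
  apply: (H y x) => //.
  - move: Un; rewrite /= !inE !negb_or (eq_sym y x).
    by move=> /and4P[/and3P[-> -> ->] /andP[-> ->] ->].
  - by move=> u; rewrite PE; ring.
  - by move=> u; rewrite dPE; ring.
have Pt : elim_quartic a s d s^-1 < 0.
  have -> : elim_quartic a s d s^-1 = - (d ^+ 2 * (1 / 2 + a)).
    rewrite /elim_quartic /quartic /elim_c4 /elim_c3 /elim_c2 /elim_c1 /elim_c0; field.
    by rewrite gt_eqF.
  by rewrite oppr_lt0 mulr_gt0 ?exprn_even_gt0 //=; lra.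
have side : 0 < (s^-1 - x) * (s^-1 - y).
  have h : 0 < - (elim_c4 a s * ((s^-1 - r) * (s^-1 - r'))).
    by rewrite oppr_gt0 pmulr_rlt0 // pmulr_rlt0 ?subr_gt0 // subr_lt0.
  rewrite -(pmulr_rgt0 _ h); move: Pt.
  rewrite /elim_quartic PE -oppr_gt0; set A := - _; set B := _ * _.
  by rewrite (_ : A = B) // /A /B; ring.
move: Un; rewrite /= !inE !negb_or => /and4P[/and3P[_ rx ry] /andP[r'x r'y] _ _].
have [yt|ty] := ltP y s^-1.
  pose T u v w := [/\ u < s^-1, v < s^-1, w < s^-1 &
    roots4 (elim_c4 a s) (elim_quartic a s d) (elim_dquartic a s d) u v w r'].
  have [|||r1 [r2 [r3 [h12 h23 [_ _ h3 h]]]]] := @sort3 _ T r x y _ _ rx ry xy.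
  - move=> u v w [hu hv hw [h1 h2]]; split=> //.
    by split=> e; rewrite ?h1 ?h2; ring.
  - move=> u v w [hu hv hw [h1 h2]]; split=> //.
    by split=> e; rewrite ?h1 ?h2; ring.
  - split=> //; first exact: lt_trans yt.
    by split=> u; rewrite ?/elim_quartic ?/elim_dquartic ?PE ?dPE; ring.
  - by apply: reduced_of_sorted h => //; rewrite h3 tr'.
have xt : s^-1 < x.
  rewrite ltNge; apply/negP => xt; move: side; rewrite ltNge => /negP; apply.
  by rewrite mulr_ge0_le0 // ?subr_ge0 // subr_le0.
pose T u v w := [/\ s^-1 < u, s^-1 < v, s^-1 < w &
  roots4 (elim_c4 a s) (elim_quartic a s d) (elim_dquartic a s d) u v w r].
have [|||r1 [r2 [r3 [h12 h23 [h3 _ _ h]]]]] := @sort3 _ T r' x y _ _ r'x r'y xy.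
- move=> u v w [hu hv hw [h1 h2]]; split=> //.
  by split=> e; rewrite ?h1 ?h2; ring.
- move=> u v w [hu hv hw [h1 h2]]; split=> //.
  by split=> e; rewrite ?h1 ?h2; ring.
- split=> //; first exact: lt_trans xy.
  by split=> u; rewrite ?/elim_quartic ?/elim_dquartic ?PE ?dPE; ring.
- by apply: reduced_of_sorted h => //; rewrite h3 rt orbT.
Qed.

Lemma reduced_two a s d : 0 < a < 1 / 2 -> 0 < s < 1 ->
  `|d| < s -> `|d| < 1 / 2 -> d != 0 ->
  quartic_disc (elim_c4 a s) (elim_c3 a s) (elim_c2 a s d) (elim_c1 a s d) (elim_c0 a s
    d) < 0 ->
  two_neg (reduced a s d) (reduced_jac a s d).
Proof.
move=> a01 s01 ds d1 d0 D.
have [r [r' [rt tr' Pr Pr']]] := elim_two_roots a01 s01 ds d1 d0.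
have /andP[a_gt0 a_lt] := a01; have /andP[s_gt0 s_lt] := s01.
have k_gt0 : 0 < elim_c4 a s by rewrite /elim_c4 mulr_gt0 ?exprn_gt0 //; lra.
have lrr' := lt_trans rt tr'.
have rr' : r != r' by rewrite lt_eqF.
have [only [k [k' [kp k'p dr dr']]]] := quartic_two_real k_gt0 rr' Pr Pr' D.
pose z r : R * R := (r, d / (1 - s * r)).
exists (z r), (z r'); split.
- by rewrite /= inE andbT; apply: contraNneq rr' => -[->].
- move=> [u v]; rewrite reduced_root //; split.
    by move=> [/only[] -> ->]; rewrite !inE eqxx ?orbT.
  by rewrite !inE => /orP[] /eqP[-> ->].
- move=> y; rewrite !inE => /orP[] /eqP ->.
    rewrite -sgr_cp0 sg_reduced_jac ?(lt_eqF rt) // /elim_dquartic dr !sgrM (gtr0_sg kp).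
    by rewrite (sg_subr_lt lrr') (sg_subr_gt rt) !mul1r mulr1.
  rewrite -sgr_cp0 sg_reduced_jac ?(gt_eqF tr') // /elim_dquartic dr' !sgrM (gtr0_sg k'p).
  by rewrite (sg_subr_gt lrr') (sg_subr_lt tr') !mul1r.
Qed.

(** The discriminant of the quadratic equation for the solutions with v = 0,
when d = 0. *)
Definition sym_disc a s : R := 1 - 4 * (1 / 2 - a) * (2 * a + s).
(** Up to the factor s^2, the value at u = 1/s of the quadratic polynomial whose
roots are the solutions with v = 0. Its sign tells whether there are solutions
on the line u = 1/s, and whether 1/s separates the roots on the line v = 0. *)
Definition sym_gap a s : R := 1 / 2 - a - s + (2 * a + s) * s ^+ 2.

Lemma sym_gap_sq a s :
  4 * (1 / 2 - a) * sym_gap a s = (1 - 2 * a - s) ^+ 2 - s ^+ 2 * sym_disc a s.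
Proof. by rewrite /sym_gap /sym_disc; field. Qed.

(** A quadratic polynomial with positive leading coefficient and a negative
value has a positive discriminant. *)
Lemma sym_gap_or_disc_gt0 a s : a < 1 / 2 ->
  0 <= sym_gap a s \/ 0 <= sym_disc a s.
Proof.
move=> a1; case: (lerP 0 (sym_disc a s)) => [|D]; first by right.
left; rewrite -(@pmulr_rge0 _ (4 * (1 / 2 - a))); last lra.
by rewrite sym_gap_sq subr_ge0 (le_trans _ (sqr_ge0 _)) // mulr_ge0_le0 ?sqr_ge0 // ltW.
Qed.

(** For a_2 = a_3 the conic q_2 = q_3 is the pair of lines v = 0 and u = 1/s. *)
Lemma reduced0 a s u v : 0 < s ->
  reduced a s 0 (u, v) <->
  (v = 0 /\ (1 / 2 - a) * u ^+ 2 - u + 2 * a + s = 0) \/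
  (u = s^-1 /\ (1 / 2 + a) * (s * v) ^+ 2 = sym_gap a s).
Proof.
move=> s0; have sn0 : s != 0 by rewrite gt_eqF.
have e0 w : reduced_eq a s 0 w 0 = (1 / 2 - a) * w ^+ 2 - w + 2 * a + s.
  by rewrite /reduced_eq; field.
have et w : reduced_eq a s 0 s^-1 w =
    (sym_gap a s - (1 / 2 + a) * (s * w) ^+ 2) / s ^+ 2.
  by rewrite /reduced_eq /sym_gap; field.
rewrite /reduced /=; split=> [[/eqP]|[[-> e]|[-> e]]].
- rewrite mulf_eq0 => /orP[/eqP -> e|]; first by left; rewrite -e0.
  rewrite subr_eq0 => /eqP su e; right.
  have eu : u = s^-1 by apply: (mulfI sn0); rewrite -su mulfV.
  split=> //; move: e; rewrite eu et => /eqP.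
  by rewrite mulf_eq0 invr_eq0 expf_eq0 (negPf sn0) orbF subr_eq0 => /eqP ->.
- by rewrite mul0r e0.
- by rewrite et e subrr mul0r mulfV // subrr mulr0.
Qed.

Lemma reduced_jac0_axis a s u :
  reduced_jac a s 0 (u, 0) = (2 * (1 / 2 - a) * u - 1) * (1 - s * u).
Proof. by rewrite /reduced_jac /=; field. Qed.

Lemma reduced_jac0_vert a s v : s != 0 ->
  reduced_jac a s 0 (s^-1, v) = - (s * (1 + 2 * a) * v ^+ 2).
Proof. by move=> s0; rewrite /reduced_jac /=; field. Qed.

(** The position of the two roots with respect to the vertex of the parabola
gives the sign of the first factor of the Jacobian determinant on v = 0, and the
last identity relates the signs of the second factor at the two roots. *)
Lemma sym_axis_roots a s : a < 1 / 2 -> 0 < sym_disc a s ->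
  exists u1 u2, [/\ 2 * (1 / 2 - a) * u1 < 1, 1 < 2 * (1 / 2 - a) * u2,
   u1 < u2,
   (forall u, (1 / 2 - a) * u ^+ 2 - u + 2 * a + s = 0 <-> u = u1 \/ u = u2) &
   (1 - s * u1) * (1 - s * u2) * (1 / 2 - a) = sym_gap a s].
Proof.
move=> a1 D; pose l := 1 / 2 - a; have l0 : 0 < l by rewrite /l; lra.
have ln0 : l != 0 by rewrite gt_eqF.
pose w := Num.sqrt (sym_disc a s); have w0 : 0 < w by rewrite sqrtr_gt0.
have w2 : w ^+ 2 = 1 - 4 * l * (2 * a + s) by rewrite sqr_sqrtr // ltW.
pose u1 := (1 - w) / (2 * l); pose u2 := (1 + w) / (2 * l).
have e1 : 2 * l * u1 = 1 - w by rewrite /u1; field.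
have e2 : 2 * l * u2 = 1 + w by rewrite /u2; field.
have es : l * (u1 + u2) = 1 by rewrite /u1 /u2; field.
have ep : l * (u1 * u2) = 2 * a + s.
  have -> : l * (u1 * u2) = (1 - w ^+ 2) / (4 * l) by rewrite /u1 /u2; field.
  by rewrite w2; field.
have fact u : l * u ^+ 2 - u + 2 * a + s = l * ((u - u1) * (u - u2)).
  rewrite -addrA -ep -[X in _ - X + _]mul1r -es; ring.
exists u1, u2; split.
- by rewrite -/l e1; lra.
- by rewrite -/l e2; lra.
- have : 2 * l * u1 < 2 * l * u2 by rewrite e1 e2; lra.
  by rewrite ltr_pM2l // mulr_gt0.
- move=> u; rewrite -/l fact; split=> [/eqP|[] ->]; last 2 first.
  + by rewrite subrr mul0r mulr0.
  + by rewrite subrr !mulr0.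
  by rewrite !mulf_eq0 (negPf ln0) /= !subr_eq0 => /orP[] /eqP; [left|right].
- have -> : (1 - s * u1) * (1 - s * u2) * (1 / 2 - a) =
    l - s * (l * (u1 + u2)) + s ^+ 2 * (l * (u1 * u2)) by rewrite /l; ring.
  by rewrite es ep /sym_gap /l; ring.
Qed.

Lemma sym_vert_roots a s : 0 < a -> 0 < s -> 0 < sym_gap a s ->
  exists2 v1, 0 < v1 &
  forall v, (1 / 2 + a) * (s * v) ^+ 2 = sym_gap a s <-> v = v1 \/ v = - v1.
Proof.
move=> a0 s0 G; have h0 : 0 < 1 / 2 + a by lra.
have hn0 : 1 / 2 + a != 0 by rewrite gt_eqF.
have sn0 : s != 0 by rewrite gt_eqF.
pose w := Num.sqrt (sym_gap a s / (1 / 2 + a)).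
have w0 : 0 < w by rewrite sqrtr_gt0 divr_gt0.
have w2 : sym_gap a s = (1 / 2 + a) * w ^+ 2.
  by rewrite sqr_sqrtr ?(ltW (divr_gt0 G h0)) // mulrC divfK.
have sw : s * (w / s) = w by rewrite mulrCA mulfV // mulr1.
exists (w / s); first by rewrite divr_gt0.
move=> v; rewrite w2; split=> [/(mulfI hn0)/eqP|[] ->]; last 2 first.
- by rewrite sw.
- by rewrite mulrN sw sqrrN.
rewrite eqf_sqr => /orP[] /eqP e; [left|right].
  by rewrite -e mulrC mulKf.
by rewrite -[w]opprK -e mulNr opprK mulrC mulKf.
Qed.

(** Both points of the line u = 1/s are saddles. On v = 0, the factors 1 - s u
have the same sign at the two roots, so exactly one of them is a node. *)
Lemma reduced0_four a s : 0 < a < 1 / 2 -> 0 < s ->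
  0 < sym_disc a s -> 0 < sym_gap a s ->
  one_pos_three_neg (reduced a s 0) (reduced_jac a s 0).
Proof.
move=> /andP[a0 a1] s0 D G; have sn0 : s != 0 by rewrite gt_eqF.
have [u1 [u2 [h1 h2 u12 uE gE]]] := sym_axis_roots a1 D.
have [v1 v1_gt0 vE] := sym_vert_roots a0 s0 G.
have v1n0 : v1 != 0 by rewrite gt_eqF.
have same : 0 < (1 - s * u1) * (1 - s * u2).
  by move: G; rewrite -gE pmulr_lgt0 //; lra.
have Kv v : v != 0 -> reduced_jac a s 0 (s^-1, v) < 0.
  move=> v0; rewrite reduced_jac0_vert // oppr_lt0 mulr_gt0 ?exprn_even_gt0 ?v0 //.
  by rewrite mulr_gt0 //; lra.
have vN : v1 != - v1 by rewrite -subr_eq0 opprK gt_eqF // addr_gt0.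
have K1 : reduced_jac a s 0 (u1, 0) = (2 * (1 / 2 - a) * u1 - 1) * (1 - s * u1).
  exact: reduced_jac0_axis.
have K2 : reduced_jac a s 0 (u2, 0) = (2 * (1 / 2 - a) * u2 - 1) * (1 - s * u2).
  exact: reduced_jac0_axis.
have inE4 y w : (y, w) = (u1, u2) \/ (y, w) = (u2, u1) -> forall z,
    reduced a s 0 z <-> z \in [:: (y, 0); (w, 0); (s^-1, v1); (s^-1, - v1)].
  move=> yw [u v]; have ywE : u = u1 \/ u = u2 <-> u = y \/ u = w.
    by case: yw => -[-> ->]; split; case; tauto.
  rewrite reduced0 // uE vE ywE; split.
    move=> [[-> [] ->]|[-> [] ->]]; by rewrite !inE !eqxx ?orbT.
  by rewrite !inE => /or4P[] /eqP[-> ->]; tauto.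
have Un y w : y != w -> uniq [:: (y, 0); (w, 0); (s^-1, v1); (s^-1, - v1)].
  move=> yw; rewrite /= !inE !xpair_eqE (negPf yw) !(eq_sym 0) oppr_eq0.
  by rewrite (negPf v1n0) (negPf vN) !andbF.
have [t1|t1] := ltP 0 (1 - s * u1).
  have t2 : 0 < 1 - s * u2 by move: same; rewrite pmulr_rgt0.
  exists (u2, 0), (u1, 0), (s^-1, v1), (s^-1, - v1); split.
  - by apply: Un; rewrite gt_eqF.
  - by apply: inE4; right.
  - by rewrite K2 mulr_gt0 //; lra.
  - move=> z; rewrite !inE => /or3P[] /eqP ->; rewrite ?Kv ?oppr_eq0 //.
    by rewrite K1 nmulr_rlt0 //; lra.
have {}t1 : 1 - s * u1 < 0.
  by rewrite lt_neqAle t1 andbT; apply: contraTneq same => ->; rewrite mul0r ltxx.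
have t2 : 1 - s * u2 < 0 by move: same; rewrite nmulr_rgt0.
exists (u1, 0), (u2, 0), (s^-1, v1), (s^-1, - v1); split.
- by apply: Un; rewrite lt_eqF.
- by apply: inE4; left.
- by rewrite K1 nmulr_rgt0 //; lra.
- move=> z; rewrite !inE => /or3P[] /eqP ->; rewrite ?Kv ?oppr_eq0 //.
  by rewrite K2 pmulr_rlt0 //; lra.
Qed.

Lemma reduced0_two_axis a s : 0 < a < 1 / 2 -> 0 < s ->
  0 < sym_disc a s -> sym_gap a s < 0 -> two_neg (reduced a s 0) (reduced_jac a s 0).
Proof.
move=> /andP[a0 a1] s0 D G.
have [u1 [u2 [h1 h2 u12 uE gE]]] := sym_axis_roots a1 D.
have opp : (1 - s * u1) * (1 - s * u2) < 0.
  by move: G; rewrite -gE pmulr_llt0 //; lra.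
have t12 : 1 - s * u2 < 1 - s * u1 by rewrite ltrD2l ltrN2 ltr_pM2l.
have [t1 t2] : 0 < 1 - s * u1 /\ 1 - s * u2 < 0 by split; nra.
exists (u1, 0), (u2, 0); split.
- by rewrite /= inE xpair_eqE (lt_eqF u12).
- move=> [u v]; rewrite reduced0 // uE; split.
    move=> [[-> [] ->]|[_ e]]; rewrite ?inE ?eqxx ?orbT //.
    by move: G; rewrite -e ltNge mulr_ge0 ?sqr_ge0 //; lra.
  by rewrite !inE => /orP[] /eqP[-> ->]; tauto.
- move=> z; rewrite !inE => /orP[] /eqP ->; rewrite reduced_jac0_axis.
    by rewrite nmulr_rlt0 //; lra.
  by rewrite pmulr_rlt0 //; lra.
Qed.

Lemma reduced0_two_vert a s : 0 < a < 1 / 2 -> 0 < s ->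
  sym_disc a s < 0 -> 0 < sym_gap a s -> two_neg (reduced a s 0) (reduced_jac a s 0).
Proof.
move=> /andP[a0 a1] s0 D G; have sn0 : s != 0 by rewrite gt_eqF.
have [v1 v1_gt0 vE] := sym_vert_roots a0 s0 G.
have Kv v : v != 0 -> reduced_jac a s 0 (s^-1, v) < 0.
  move=> v0; rewrite reduced_jac0_vert // oppr_lt0 mulr_gt0 ?exprn_even_gt0 ?v0 //.
  by rewrite mulr_gt0 //; lra.
have vN : v1 != - v1 by rewrite -subr_eq0 opprK gt_eqF // addr_gt0.
exists (s^-1, v1), (s^-1, - v1); split.
- by rewrite /= inE xpair_eqE (negPf vN) andbF.
- move=> [u v]; rewrite reduced0 // vE; split.
    move=> [[_ e]|[-> [] ->]]; rewrite ?inE ?eqxx ?orbT //.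
    move: D; rewrite ltNge => /negP[].
    have -> : sym_disc a s = (2 * (1 / 2 - a) * u - 1) ^+ 2 -
      4 * (1 / 2 - a) * ((1 / 2 - a) * u ^+ 2 - u + 2 * a + s).
      by rewrite /sym_disc; field.
    by rewrite e mulr0 subr0 sqr_ge0.
  by rewrite !inE => /orP[] /eqP[-> ->]; tauto.
- by move=> z; rewrite !inE => /orP[] /eqP ->; rewrite Kv ?oppr_eq0 // gt_eqF.
Qed.

End Elimination.

(** * The sign of Q decides the number of solutions *)

Section Classification.
Variable R : realType.
Implicit Types a : R.

(** The quartic comes from projecting the conic q_2 = q_3 from one of its own
points, so its discriminant is that of the pair of conics (which is Q, up to
a constant) times a power of the determinant of this conic. *)
Lemma elim_disc_Qpoly a1 a2 a3 : let s := a2 + a3 in let d := a2 - a3 in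
  4 * quartic_disc (elim_c4 a1 s) (elim_c3 a1 s) (elim_c2 a1 s d) (elim_c1 a1 s d)
    (elim_c0 a1 s d) =
  - (s ^+ 4 * d ^+ 2 * Qpoly a1 a2 a3).
Proof. by rewrite /= /quartic_disc /elim_c4 /elim_c3 /elim_c2 /elim_c1 /elim_c0 /Qpoly;
  field. Qed.

(** On the plane a_2 = a_3, Q still detects coincidences of solutions: of the
two on v = 0 (the discriminant), and of those on u = 1/s with each other and
with one on v = 0 (the gap). *)
Lemma Qpoly_sym a b : Qpoly a b b =
  - (16 * sym_disc a (b + b) * sym_gap a (b + b) ^+ 3 * (1 / 2 + a)).
Proof. by rewrite /Qpoly /sym_disc /sym_gap; field. Qed.

Lemma reduced_classification a1 a2 a3 :
  0 < a1 < 1 / 2 -> 0 < a2 < 1 / 2 -> 0 < a3 < 1 / 2 ->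
  let C := reduced a1 (a2 + a3) (a2 - a3) in
  let k := reduced_jac a1 (a2 + a3) (a2 - a3) in
  (Qpoly a1 a2 a3 < 0 -> one_pos_three_neg C k) /\
  (0 < Qpoly a1 a2 a3 -> two_neg C k).
Proof.
move=> h1 /andP[? ?] /andP[? ?] /=; have /andP[? ?] := h1.
have s01 : 0 < a2 + a3 < 1 by apply/andP; split; lra.
have s0 : 0 < a2 + a3 by lra.
have [<-|d0] := eqVneq a2 a3.
  rewrite subrr Qpoly_sym !(oppr_lt0, oppr_gt0).
  set D := sym_disc _ _.
  set G := sym_gap _ _.
  have -> : 16 * D * G ^+ 3 * (1 / 2 + a1) = 16 * (1 / 2 + a1) * (D * G ^+ 3).
    by ring.
  have h16 : 0 < 16 * (1 / 2 + a1) by lra.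
  rewrite (pmulr_rgt0 _ h16) (pmulr_rlt0 _ h16).
  have ss0 : 0 < a2 + a2 by lra.
  have G2 : 0 <= G ^+ 2 by exact: sqr_ge0.
  have GD : 0 <= G \/ 0 <= D by apply: sym_gap_or_disc_gt0.
  split=> DG.
    have [D0|D0] := ltP 0 D.
      apply: reduced0_four => //; move: DG; rewrite pmulr_rgt0 //.
      by rewrite exprn_odd_gt0.
    have D00 : D < 0.
      rewrite lt_neqAle D0 andbT; apply: contraTneq DG => ->.
      by rewrite mul0r ltxx.
    have G0 : 0 <= G by case: GD => // D0'; lra.
    by move: DG; rewrite nmulr_rgt0 // exprn_odd_lt0 // ltNge G0.
  have [D0|D0] := ltP 0 D.
    apply: reduced0_two_axis => //; move: DG; rewrite pmulr_rlt0 //.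
    by rewrite exprn_odd_lt0.
  have D00 : D < 0.
    rewrite lt_neqAle D0 andbT; apply: contraTneq DG => ->.
    by rewrite mul0r ltxx.
  apply: reduced0_two_vert => //; move: DG; rewrite nmulr_rlt0 //.
  by rewrite exprn_odd_gt0.
have d0' : a2 - a3 != 0 by rewrite subr_eq0.
have ds : `|a2 - a3| < a2 + a3 by rewrite ltr_norml; apply/andP; split; lra.
have d1 : `|a2 - a3| < 1 / 2 by rewrite ltr_norml; apply/andP; split; lra.
have sd0 : 0 < (a2 + a3) ^+ 4 * (a2 - a3) ^+ 2.
  by rewrite mulr_gt0 ?exprn_even_gt0 //= gt_eqF.
have := elim_disc_Qpoly a1 a2 a3; rewrite /=; set D := quartic_disc _ _ _ _ _ => discE.
split=> Q0.
  apply: reduced_four => //; rewrite -/D -(@pmulr_rgt0 _ 4) // discE oppr_gt0.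
  by rewrite pmulr_rlt0.
apply: reduced_two => //; rewrite -/D -(@pmulr_rlt0 _ 4) // discE oppr_lt0.
by rewrite pmulr_rgt0.
Qed.
End Classification.

(** * Real solutions are positive *)

Section Positivity.
Variable R : rcfType.
Implicit Types (a x u v : R).

(** For (a_i; x_i, x_j, x_k) this is 2 x_1 x_2 x_3 times the i-th principal
Ricci curvature of the metric (x_1, x_2, x_3). *)
Definition ric_form a x y z : R := y * z + a * (x ^+ 2 - y ^+ 2 - z ^+ 2).

Lemma ric_form_swap a x y z : ric_form a x y z = ric_form a x z y.
Proof. by rewrite /ric_form; ring. Qed.

(** If x_2 = 0 then q_1 = q_3 forces x_1^2 = x_3^2, hence q_1 = 0, while q_2 =
x_1 x_3 - 2 a_2 x_1^2 is nonzero because 0 < 2 a_2 < 1. *)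
Lemma ric_form_coord_neq0 a1 a2 a3 x1 x3 : 0 < a1 -> 0 < a2 < 1 / 2 -> 0 < a3 ->
  x1 != 0 -> ric_form a1 x1 0 x3 = ric_form a2 0 x1 x3 ->
    ric_form a2 0 x1 x3 = ric_form a3 x3 x1 0 -> False.
Proof.
move=> a10 /andP[a20 a21] a30 x10; rewrite /ric_form !mul0r !mulr0 !expr0n /= => e12 e23.
have e : (a1 + a3) * (x1 ^+ 2 - x3 ^+ 2) = 0 by lra.
have h : x1 ^+ 2 = x3 ^+ 2.
  move/eqP: e; rewrite mulf_eq0 subr_eq0 => /orP[/eqP|/eqP //]; lra.
have x12 : 0 < x1 ^+ 2 by rewrite exprn_even_gt0 //= x10.
have e' : x1 * x3 = 2 * a2 * x1 ^+ 2 by rewrite h in e12 *; lra.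
move/eqP: h; rewrite eqf_sqr => /orP[] /eqP h.
  have : (1 - 2 * a2) * x1 ^+ 2 = 0 by rewrite mulrBl -e' -h; ring.
  by move/eqP; rewrite mulf_eq0 (gt_eqF x12) orbF => /eqP; lra.
have : (1 + 2 * a2) * x1 ^+ 2 = 0.
  by rewrite mulrDl -e' (_ : x3 = - x1) ?h ?opprK //; ring.
by move/eqP; rewrite mulf_eq0 (gt_eqF x12) orbF => /eqP; lra.
Qed.

(** Take x_3 <= x_1. Then q_3 <= 0. On the other hand q_1 = q_3 bounds x_1 - x_3
by - x_2, which makes q_2 = (1 - 2 a_2) x_1 x_3 + a_2 (x_2^2 - (x_1 - x_3)^2)
positive. *)
Lemma ric_form_same_sign a1 a2 a3 x1 x2 x3 :
  0 < a1 < 1 / 2 -> 0 < a2 < 1 / 2 -> 0 < a3 < 1 / 2 ->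
  0 < x1 -> x2 < 0 -> 0 < x3 ->
  ric_form a1 x1 x2 x3 = ric_form a2 x2 x1 x3 ->
    ric_form a2 x2 x1 x3 = ric_form a3 x3 x1 x2 -> False.
Proof.
wlog x31 : a1 a3 x1 x3 / x3 <= x1.
  move=> H h1 h2 h3 x10 x20 x30 e12 e23.
  have [x31|/ltW x13] := leP x3 x1; first exact: (H a1 a3 x1 x3).
  apply: (H a3 a1 x3 x1) => //.
    by rewrite (ric_form_swap a3 x3 x2) (ric_form_swap a2 x2 x3) e23.
  by rewrite (ric_form_swap a2 x2 x3) (ric_form_swap a1 x1 x3) e12.
move=> /andP[a10 a11] /andP[a20 a21] /andP[a30 a31] x10 x20 x30 e12 e23.
have e13 : x2 * (x3 - x1) + (a1 + a3) * (x1 ^+ 2 - x3 ^+ 2) = (a1 - a3) * x2 ^+ 2.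
  by move: e12; rewrite e23 /ric_form => e12; lra.
have s13 : 0 <= x1 ^+ 2 - x3 ^+ 2.
  by rewrite subr_sqr mulr_ge0 ?subr_ge0 // addr_ge0 // ltW.
have q3_le0 : ric_form a3 x3 x1 x2 <= 0.
  have : x1 * x2 <= 0 by rewrite mulr_ge0_le0 // ltW.
  have : 0 <= a3 * (x1 ^+ 2 - x3 ^+ 2 + x2 ^+ 2).
    exact: mulr_ge0 (ltW a30) (addr_ge0 s13 (sqr_ge0 _)).
  by rewrite /ric_form; lra.
have x22 : 0 < x2 ^+ 2 by rewrite exprn_even_gt0 //= lt_eqF.
have far : (x1 - x3) ^+ 2 <= x2 ^+ 2.
  suff : x1 - x3 <= - x2.
    move=> h; rewrite -(sqrrN x2) ler_pXn2r // nnegrE; lra.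
  have h1 : 0 <= (a1 + a3) * (x1 ^+ 2 - x3 ^+ 2) by rewrite mulr_ge0 //; lra.
  have h2 : (a1 - a3) * x2 ^+ 2 <= 1 * x2 ^+ 2 by rewrite ler_pM2r //; lra.
  by rewrite -(@ler_pM2l _ (- x2)) ?oppr_gt0 //; move: e13 h1 h2; lra.
have : 0 < ric_form a2 x2 x1 x3.
  have h1 : 0 < (1 - 2 * a2) * (x1 * x3) by rewrite !mulr_gt0 //; lra.
  have h2 : 0 <= a2 * (x2 ^+ 2 - (x1 - x3) ^+ 2).
    by rewrite mulr_ge0 ?subr_ge0 // ltW.
  rewrite (_ : ric_form _ _ _ _ = (1 - 2 * a2) * (x1 * x3) +
    a2 * (x2 ^+ 2 - (x1 - x3) ^+ 2)); last by rewrite /ric_form; ring.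
  by lra.
by rewrite e23 ltNge q3_le0.
Qed.

Lemma reduced_ric_form a1 a2 a3 x1 x2 x3 : x1 != 0 ->
  reduced a1 (a2 + a3) (a2 - a3) ((x2 + x3) / x1, (x3 - x2) / x1) <->
  ric_form a1 x1 x2 x3 = ric_form a2 x2 x1 x3 /\
    ric_form a2 x2 x1 x3 = ric_form a3 x3 x1 x2.
Proof.
move=> x10; rewrite /reduced /=.
have e1 : reduced_eq a1 (a2 + a3) (a2 - a3) ((x2 + x3) / x1) ((x3 - x2) / x1) =
  (2 * ric_form a1 x1 x2 x3 - ric_form a2 x2 x1 x3 - ric_form a3 x3 x1 x2) / x1 ^+ 2.
  by rewrite /reduced_eq /ric_form; field.
have e2 : (x3 - x2) / x1 * (1 - (a2 + a3) * ((x2 + x3) / x1)) - (a2 - a3) =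
  (ric_form a2 x2 x1 x3 - ric_form a3 x3 x1 x2) / x1 ^+ 2 by rewrite /ric_form; field.
have k0 : x1 ^+ 2 != 0 by rewrite expf_neq0.
rewrite e1; split=> [[/eqP]|[h1 h2]].
  rewrite -subr_eq0 e2 mulf_eq0 invr_eq0 (negPf k0) orbF subr_eq0 => /eqP ->.
  by move/eqP; rewrite mulf_eq0 invr_eq0 (negPf k0) orbF => /eqP; lra.
split; last by rewrite h1 h2; field.
by apply/eqP; rewrite -subr_eq0 e2 h2 subrr mul0r.
Qed.

Lemma ric_form_opp a x y z : ric_form a (- x) (- y) (- z) = ric_form a x y z.
Proof. by rewrite /ric_form; ring. Qed.

(** The sign patterns are reduced to the one of [ric_form_same_sign] by
permuting the indices and changing all signs. *)
Lemma reduced_pos a1 a2 a3 u v :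
  0 < a1 < 1 / 2 -> 0 < a2 < 1 / 2 -> 0 < a3 < 1 / 2 ->
  reduced a1 (a2 + a3) (a2 - a3) (u, v) -> 0 < (u - v) / 2 /\ 0 < (u + v) / 2.
Proof.
move=> h1 h2 h3; have /andP[a10 _] := h1; have /andP[a20 _] := h2.
have /andP[a30 _] := h3; set x2 := (u - v) / 2; set x3 := (u + v) / 2.
have -> : (u, v) = ((x2 + x3) / 1, (x3 - x2) / 1).
  by congr (_, _); rewrite /x2 /x3; field.
rewrite reduced_ric_form ?oner_eq0 // => -[e12 e23].
have e13 := etrans e12 e23.
have n1 : (1 : R) != 0 by exact: oner_neq0.
have x2n0 : x2 != 0.
  apply/eqP => x20; rewrite x20 in e12 e23.
  exact: (ric_form_coord_neq0 a10 h2 a30 n1 e12 e23).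
have x3n0 : x3 != 0.
  apply/eqP => x30; rewrite x30 (ric_form_swap a1) (ric_form_swap a2) in e13 e12 e23.
  by apply: (ric_form_coord_neq0 a10 h3 a20 n1 e13); rewrite -e23 ric_form_swap.
split; rewrite ltNge le_eqVlt negb_or ?x2n0 ?x3n0 /=; apply/negP => neg.
  have [x30|x30] := ltP 0 x3; first exact: (ric_form_same_sign h1 h2 h3 ltr01 neg x30).
  have {}x30 : x3 < 0 by rewrite lt_neqAle x3n0.
  apply: (@ric_form_same_sign a2 a1 a3 (- x2) (- 1) (- x3)) => //;
    rewrite ?oppr_gt0 ?oppr_lt0 ?ltr01 ?ric_form_opp //.
  by rewrite e13 ric_form_swap.
have [x20|x20] := ltP 0 x2.
  apply: (@ric_form_same_sign a1 a3 a2 1 x3 x2) => //.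
  by rewrite ric_form_swap e13.
have {}x20 : x2 < 0 by rewrite lt_neqAle x2n0.
apply: (@ric_form_same_sign a2 a1 a3 (- x2) (- 1) (- x3)) => //;
  rewrite ?oppr_gt0 ?oppr_lt0 ?ltr01 ?ric_form_opp //.
by rewrite e13 ric_form_swap.
Qed.

End Positivity.

(** * Singular points and ratios of coordinates *)

Section Ratios.
Variable R : realType.
Implicit Types (a x u v t : R) (p : 'rV[R]_2) (z : R * R).

(** In the field, B plays the role of this mean: B = ric_mean / (x_1 x_2 x_3).
*)
Definition ric_mean a1 a2 a3 x1 x2 x3 : R :=
  (ric_form a1 x1 x2 x3 / a1 + ric_form a2 x2 x1 x3 / a2 + ric_form a3 x3 x1 x2 / a3) /
  (a1^-1 + a2^-1 + a3^-1).

Lemma f_ric_form a1 a2 a3 x1 x2 x3 : 0 < a1 -> 0 < a2 -> 0 < a3 ->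
  x1 != 0 -> x2 != 0 -> x3 != 0 ->
  f a1 a2 a3 x1 x2 x3 = (ric_mean a1 a2 a3 x1 x2 x3 - ric_form a1 x1 x2 x3) / (x2 * x3).
Proof.
move=> a10 a20 a30 x10 x20 x30; rewrite /f /B /ric_mean /ric_form; field.
rewrite x10 x20 x30 ?gt_eqF //.
by rewrite !(addr_gt0, mulr_gt0).
Qed.

Lemma g_ric_form a1 a2 a3 x1 x2 x3 : 0 < a1 -> 0 < a2 -> 0 < a3 ->
  x1 != 0 -> x2 != 0 -> x3 != 0 ->
  g a1 a2 a3 x1 x2 x3 = (ric_mean a1 a2 a3 x1 x2 x3 - ric_form a2 x2 x1 x3) / (x1 * x3).
Proof.
move=> a10 a20 a30 x10 x20 x30; rewrite /g /B /ric_mean /ric_form; field.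
rewrite x10 x20 x30 ?gt_eqF //.
by rewrite !(addr_gt0, mulr_gt0).
Qed.

Lemma ric_mean_eq a1 a2 a3 x1 x2 x3 : 0 < a1 -> 0 < a2 -> 0 < a3 ->
  ric_form a1 x1 x2 x3 = ric_form a2 x2 x1 x3 ->
    ric_form a2 x2 x1 x3 = ric_form a3 x3 x1 x2 ->
  ric_mean a1 a2 a3 x1 x2 x3 = ric_form a2 x2 x1 x3.
Proof.
move=> a10 a20 a30 e12 e23.
have w0 : 0 < a1^-1 + a2^-1 + a3^-1 by rewrite !addr_gt0 ?invr_gt0.
by rewrite /ric_mean e12 -e23 -!mulrDr mulfK // gt_eqF.
Qed.

(** If q_1 and q_2 are equal to the weighted mean of the three, so is q_3. *)
Lemma fg_eq0_ric_form a1 a2 a3 x1 x2 x3 : 0 < a1 -> 0 < a2 -> 0 < a3 ->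
  x1 != 0 -> x2 != 0 -> x3 != 0 ->
  f a1 a2 a3 x1 x2 x3 = 0 /\ g a1 a2 a3 x1 x2 x3 = 0 <->
  ric_form a1 x1 x2 x3 = ric_form a2 x2 x1 x3 /\
    ric_form a2 x2 x1 x3 = ric_form a3 x3 x1 x2.
Proof.
move=> a10 a20 a30 x10 x20 x30; rewrite f_ric_form // g_ric_form //.
have w0 : 0 < a1^-1 + a2^-1 + a3^-1 by rewrite !addr_gt0 ?invr_gt0.
have wE : ric_mean a1 a2 a3 x1 x2 x3 * (a1^-1 + a2^-1 + a3^-1) =
  ric_form a1 x1 x2 x3 / a1 + ric_form a2 x2 x1 x3 / a2 + ric_form a3 x3 x1 x2 / a3.
  by rewrite /ric_mean divfK // gt_eqF.
split=> [[/eqP + /eqP]|[e12 e23]].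
  rewrite !mulf_eq0 !invr_eq0 !mulf_eq0 (negPf x10) (negPf x20) (negPf x30) !orbF.
  rewrite !subr_eq0 => /eqP e1 /eqP e2; split; first by rewrite -e1 -e2.
  apply: (mulIf (x := a3^-1)); first by rewrite invr_eq0 gt_eqF.
  by move: wE; rewrite -e1 -e2; lra.
by rewrite ric_mean_eq // e12 subrr !mul0r.
Qed.

Lemma phi_gt0 a1 a2 a3 x1 x2 : 0 < x1 -> 0 < x2 -> 0 < phi a1 a2 a3 x1 x2.
Proof. by move=> x10 x20; rewrite /phi mulr_gt0 // powR_gt0. Qed.

Lemma singular_ric_form a1 a2 a3 p : 0 < a1 -> 0 < a2 -> 0 < a3 ->
  singular_point a1 a2 a3 p ->
  let x3 := phi a1 a2 a3 (p 0 0) (p 0 1) in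
  ric_form a1 (p 0 0) (p 0 1) x3 = ric_form a2 (p 0 1) (p 0 0) x3 /\
  ric_form a2 (p 0 1) (p 0 0) x3 = ric_form a3 x3 (p 0 0) (p 0 1).
Proof.
move=> a10 a20 a30 [x10 x20 f0 g0] x3.
have x30 : 0 < x3 := phi_gt0 a1 a2 a3 x10 x20.
by apply/fg_eq0_ric_form; rewrite ?gt_eqF.
Qed.

Definition ratios a1 a2 a3 p : R * R :=
  let x3 := phi a1 a2 a3 (p 0 0) (p 0 1) in
  ((p 0 1 + x3) / p 0 0, (x3 - p 0 1) / p 0 0).

Lemma singular_ratios a1 a2 a3 p : 0 < a1 -> 0 < a2 -> 0 < a3 ->
  singular_point a1 a2 a3 p <->
  [/\ 0 < p 0 0, 0 < p 0 1 &
      reduced a1 (a2 + a3) (a2 - a3) (ratios a1 a2 a3 p)].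
Proof.
move=> a10 a20 a30; rewrite /singular_point /ratios /=.
have key : 0 < p 0 0 -> 0 < p 0 1 ->
   ftilde a1 a2 a3 (p 0 0) (p 0 1) = 0 /\ gtilde a1 a2 a3 (p 0 0) (p 0 1) = 0 <->
   reduced a1 (a2 + a3) (a2 - a3) (ratios a1 a2 a3 p).
  move=> x10 x20; have x30 := phi_gt0 a1 a2 a3 x10 x20.
  by rewrite /ftilde /gtilde fg_eq0_ric_form ?gt_eqF // /ratios reduced_ric_form ?gt_eqF.
split=> [[x10 x20 e1 e2]|[x10 x20 c]].
  by split=> //; apply/(key x10 x20).
by have [e1 e2] := (key x10 x20).2 c.
Qed.

(** The scaling factor t is the first coordinate of the point where the ray
through (1, x2, x3) meets the surface x_3 = phi; it solves the equation of
[phi_scale]. *)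
Definition of_ratios a1 a2 a3 z : 'rV[R]_2 :=
  let x2 := (z.1 - z.2) / 2 in let x3 := (z.1 + z.2) / 2 in
  let t := (x2 `^ (- (a3 / a2)) / x3) `^ (1 + a3 / a1 + a3 / a2)^-1 in
  vec2 t (t * x2).

Lemma phi_scale a1 a2 a3 t x2 : 0 < t -> 0 < x2 ->
  phi a1 a2 a3 t (t * x2) * t `^ (1 + a3 / a1 + a3 / a2) =
  t * x2 `^ (- (a3 / a2)).
Proof.
move=> t0 x20; have tn0 : t != 0 by rewrite gt_eqF.
rewrite /phi powRM ?ltW // mulrAC !mulrA -!powRD ?tn0 ?implybT //.
rewrite (_ : _ + - (a3 / a2) = 1); last by ring.
by rewrite powRr1 // ltW.
Qed.

Lemma vec2E (x y : R) : (vec2 x y) 0 0 = x /\ (vec2 x y) 0 1 = y.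
Proof. by rewrite /vec2 !mxE. Qed.

Lemma vec2_eta p : vec2 (p 0 0) (p 0 1) = p.
Proof.
apply/rowP => i; rewrite mxE; case: i => -[|[|//]] h /=; congr (p 0 _);
  exact: val_inj.
Qed.

Lemma of_ratiosK a1 a2 a3 p : 0 < a1 -> 0 < a2 -> 0 < a3 ->
  0 < p 0 0 -> 0 < p 0 1 -> of_ratios a1 a2 a3 (ratios a1 a2 a3 p) = p.
Proof.
move=> a10 a20 a30 t0 y0; rewrite -[RHS]vec2_eta /of_ratios /ratios /=.
set t := p 0 0 in t0 *; set y := p 0 1 in y0 *.
have x30 := phi_gt0 a1 a2 a3 t0 y0; set x3 := phi _ _ _ _ _ in x30 *.
have tn0 : t != 0 by rewrite gt_eqF.
have e0 : 0 < 1 + a3 / a1 + a3 / a2 by rewrite !addr_gt0 ?divr_gt0.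
have -> : ((y + x3) / t - (x3 - y) / t) / 2 = y / t by field.
have -> : ((y + x3) / t + (x3 - y) / t) / 2 = x3 / t by field.
have yE : y = t * (y / t) by rewrite mulrCA mulfV ?mulr1.
have := phi_scale a1 a2 a3 t0 (divr_gt0 y0 t0); rewrite -yE -/x3 => sc.
have -> : (y / t) `^ (- (a3 / a2)) / (x3 / t) = t `^ (1 + a3 / a1 + a3 / a2).
  apply: (mulfI (lt0r_neq0 x30)); rewrite sc; field.
  by rewrite tn0 gt_eqF.
by rewrite -powRrM mulfV ?gt_eqF // powRr1 ?ltW // -yE.
Qed.

Lemma ratiosK a1 a2 a3 z : 0 < a1 -> 0 < a2 -> 0 < a3 ->
  0 < (z.1 - z.2) / 2 -> 0 < (z.1 + z.2) / 2 ->
  [/\ 0 < of_ratios a1 a2 a3 z 0 0, 0 < of_ratios a1 a2 a3 z 0 1 &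
   ratios a1 a2 a3 (of_ratios a1 a2 a3 z) = z].
Proof.
move=> a10 a20 a30; rewrite /of_ratios; set x2 := _ / 2; set x3 := _ / 2.
move=> x20 x30; set e := 1 + _ + _; set t := _ `^ e^-1.
have e0 : 0 < e by rewrite !addr_gt0 ?divr_gt0.
have w0 : 0 < x2 `^ (- (a3 / a2)) / x3 by rewrite divr_gt0 // powR_gt0.
have t0 : 0 < t by rewrite powR_gt0.
have te : t `^ e = x2 `^ (- (a3 / a2)) / x3.
  by rewrite /t -powRrM mulVf ?gt_eqF // powRr1 // ltW.
have [v1 v2] := vec2E t (t * x2); rewrite /ratios v1 v2 mulr_gt0 //; split=> //.
have pE : phi a1 a2 a3 t (t * x2) = t * x3.
  have := phi_scale a1 a2 a3 t0 x20; rewrite -/e te => sc.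
  have k0 : x2 `^ (- (a3 / a2)) / x3 != 0 by rewrite gt_eqF.
  by apply: (mulIf k0); rewrite sc; field; rewrite gt_eqF.
rewrite pE [RHS]surjective_pairing; congr (_, _); rewrite /x2 /x3; field;
  by rewrite gt_eqF.
Qed.
End Ratios.

(** * The Jacobian matrix at a singular point *)

Section Jacobian.
Variable R : realType.
Implicit Types (a x u v t : R) (p : 'rV[R]_2).

Definition dric_form (a x y z dx dy dz : R) : R :=
  dy * z + y * dz + 2 * a * (x * dx - y * dy - z * dz).

Definition dric_mean a1 a2 a3 x1 x2 x3 d1 d2 d3 : R :=
  (dric_form a1 x1 x2 x3 d1 d2 d3 / a1 + dric_form a2 x2 x1 x3 d2 d1 d3 / a2
   + dric_form a3 x3 x1 x2 d3 d1 d2 / a3) / (a1^-1 + a2^-1 + a3^-1).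

Section DifferentiableAt.
Variables (p : 'rV[R]_2).
Implicit Types h k : 'rV[R]_2 -> R.
(** The closure rules are restated for functions given pointwise, the form in
which the components of the field appear. *)
Lemma differentiable_add h k : differentiable h p -> differentiable k p ->
  differentiable (fun y => h y + k y) p.
Proof. exact: differentiableD. Qed.
Lemma differentiable_mul h k : differentiable h p -> differentiable k p ->
  differentiable (fun y => h y * k y) p.
Proof. exact: differentiableM. Qed.
Lemma differentiable_opp h : differentiable h p -> differentiable (fun y => - h y) p.
Proof. exact: differentiableN. Qed.
Lemma differentiable_inv h : differentiable h p -> h p != 0 ->
  differentiable (fun y => (h y)^-1) p.
Proof. exact: differentiableV. Qed.
Lemma differentiable_powR h a : differentiable h p -> 0 < h p ->
  differentiable (fun y => h y `^ a) p.
Proof.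
move=> hd h0; have pd : differentiable (fun s : R => s `^ a) (h p).
  by apply/derivable1_diffP; have [] := is_derive1_powR a h0.
exact: (differentiable_comp hd pd).
Qed.
End DifferentiableAt.

Lemma differentiable_field a1 a2 a3 p : 0 < a1 -> 0 < a2 -> 0 < a3 ->
  0 < p 0 0 -> 0 < p 0 1 -> differentiable (field a1 a2 a3) p.
Proof.
move=> a10 a20 a30 x10 x20; have x30 := phi_gt0 a1 a2 a3 x10 x20.
have d1 : differentiable (fun p : 'rV[R]_2 => p 0 0) p.
  exact: differentiable_coord.
have d2 : differentiable (fun p : 'rV[R]_2 => p 0 1) p.
  exact: differentiable_coord.
have d3 : differentiable (fun p : 'rV[R]_2 => phi a1 a2 a3 (p 0 0) (p 0 1)) p.
  by rewrite /phi; apply: differentiable_mul; apply: differentiable_powR.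
have df : differentiable (fun p => ftilde a1 a2 a3 (p 0 0) (p 0 1)) p.
  rewrite /ftilde /f /B.
  by repeat first [exact: d1 | exact: d2 | exact: d3 | exact: differentiable_cst
    | apply: differentiable_add | apply: differentiable_opp | apply: differentiable_mul |
      apply: differentiable_inv];
  rewrite /= ?mulf_neq0 ?gt_eqF ?addr_gt0 ?invr_gt0 ?powR_gt0 //.
have dg : differentiable (fun p => gtilde a1 a2 a3 (p 0 0) (p 0 1)) p.
  rewrite /gtilde /g /B.
  by repeat first [exact: d1 | exact: d2 | exact: d3 | exact: differentiable_cst
    | apply: differentiable_add | apply: differentiable_opp | apply: differentiable_mul |
      apply: differentiable_inv];
  rewrite /= ?mulf_neq0 ?gt_eqF ?addr_gt0 ?invr_gt0 ?powR_gt0 //.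
have -> : field a1 a2 a3 =
  (fun p => ftilde a1 a2 a3 (p 0 0) (p 0 1) *: delta_mx 0 0 : 'rV[R]_2) +
  (fun p => gtilde a1 a2 a3 (p 0 0) (p 0 1) *: delta_mx 0 1).
  apply/funext => y; apply/rowP => i.
  rewrite /field /GRing.add /= !mxE; case: i => -[|[|//]] i2 /=;
  by rewrite ?mulr1 ?mulr0 ?addr0 ?add0r.
by apply: differentiableD; apply: differentiableZl.
Qed.

(** Directional derivatives along the axes are one-variable derivatives, which
gives access to the rules for real functions, in particular for powers. *)
Lemma partial0 (h : R -> R -> R) p :
  'D_(delta_mx 0 0) (fun p : 'rV[R]_2 => h (p 0 0) (p 0 1)) p =
  'D_1 (fun t => h t (p 0 1)) (p 0 0).
Proof.
rewrite /derive; set F := (X in lim (X @ _)); set G := (X in _ = lim (X @ _)).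
suff -> : F = G by [].
by apply/funext => t; rewrite /F /G /= !mxE /= mulr0 add0r.
Qed.

Lemma partial1 (h : R -> R -> R) p :
  'D_(delta_mx 0 1) (fun p : 'rV[R]_2 => h (p 0 0) (p 0 1)) p =
  'D_1 (fun t => h (p 0 0) t) (p 0 1).
Proof.
rewrite /derive; set F := (X in lim (X @ _)); set G := (X in _ = lim (X @ _)).
suff -> : F = G by [].
by apply/funext => t; rewrite /F /G /= !mxE /= mulr0 add0r.
Qed.

Lemma J_entry a1 a2 a3 p i j : differentiable (field a1 a2 a3) p ->
  J a1 a2 a3 p i j = 'D_(delta_mx 0 j) (fun y => field a1 a2 a3 y 0 i) p.
Proof.
move=> d; rewrite /J mxE /jacobian /lin1_mx mxE -deriveE //.
by rewrite derive_mx ?mxE //; apply: diff_derivable.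
Qed.

Section Curve.
Variables (t : R) (X Y Z : R -> R) (dX dY dZ : R).
Hypotheses (hX : is_derive t 1 X dX) (hY : is_derive t 1 Y dY)
  (hZ : is_derive t 1 Z dZ).

Lemma is_derive_ric_form a : is_derive t 1 (fun s => ric_form a (X s) (Y s) (Z s))
  (dric_form a (X t) (Y t) (Z t) dX dY dZ).
Proof.
have -> : (fun s => ric_form a (X s) (Y s) (Z s)) =
  Y * Z + a \*: (X ^+ 2 - Y ^+ 2 - Z ^+ 2) by [].
apply: is_derive_eq; rewrite /dric_form /GRing.scale /=; ring.
Qed.

Lemma is_derive_pos_near : 0 < X t -> \forall s \near t, 0 < X s.
Proof.
move=> X0; have cX : {for t, continuous X}.
  apply/differentiable_continuous/derivable1_diffP.
  exact: (@ex_derive _ _ _ _ _ _ _ hX).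
exact: (cvgr_gt _ cX).
Qed.
End Curve.

(** At a zero of N only the derivative of N contributes; this keeps the entries
of the Jacobian matrix linear in the differentials of the q_i. *)
Lemma is_derive_quot0 t (N k : R -> R) dN : is_derive t 1 N dN ->
  derivable k t 1 -> N t = 0 ->
  is_derive t 1 (fun s => N s * k s) (dN * k t).
Proof.
move=> hN /derivableP hk N0; have -> : (fun s => N s * k s) = N * k by [].
by apply: is_derive_eq; rewrite N0 scale0r add0r /GRing.scale /= mulrC.
Qed.

Section FieldAlongCurve.
Variables (t : R) (X Y Z : R -> R) (dX dY dZ : R).
Hypotheses (hX : is_derive t 1 X dX) (hY : is_derive t 1 Y dY)
  (hZ : is_derive t 1 Z dZ).
Hypotheses (X0 : 0 < X t) (Y0 : 0 < Y t) (Z0 : 0 < Z t).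
Variables a1 a2 a3 : R.
Hypotheses (a10 : 0 < a1) (a20 : 0 < a2) (a30 : 0 < a3).

Lemma is_derive_ric_mean : is_derive t 1 (fun s => ric_mean a1 a2 a3 (X s) (Y s) (Z s))
  (dric_mean a1 a2 a3 (X t) (Y t) (Z t) dX dY dZ).
Proof.
have h1 := is_derive_ric_form hX hY hZ a1; have h2 := is_derive_ric_form hY hX hZ a2.
have h3 := is_derive_ric_form hZ hX hY a3.
have -> : (fun s => ric_mean a1 a2 a3 (X s) (Y s) (Z s)) =
  (a1^-1 + a2^-1 + a3^-1)^-1 \*:
  (a1^-1 \*: (fun s => ric_form a1 (X s) (Y s) (Z s))
   + a2^-1 \*: (fun s => ric_form a2 (Y s) (X s) (Z s))
   + a3^-1 \*: (fun s => ric_form a3 (Z s) (X s) (Y s))).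
  apply/funext => s; transitivity ((a1^-1 + a2^-1 + a3^-1)^-1 *
    (a1^-1 * ric_form a1 (X s) (Y s) (Z s) + a2^-1 * ric_form a2 (Y s) (X s) (Z s)
     + a3^-1 * ric_form a3 (Z s) (X s) (Y s))) => //.
  by rewrite /ric_mean; ring.
apply: is_derive_eq; rewrite /dric_mean /GRing.scale /=; ring.
Qed.

Let cX := is_derive_pos_near hX X0.
Let cY := is_derive_pos_near hY Y0.
Let cZ := is_derive_pos_near hZ Z0.

(** Near t the function is (ric_mean - q_1) / (x_2 x_3), and its numerator
vanishes at t. *)
Lemma is_derive_f :
  ric_mean a1 a2 a3 (X t) (Y t) (Z t) - ric_form a1 (X t) (Y t) (Z t) = 0 ->
  is_derive t 1 (fun s => f a1 a2 a3 (X s) (Y s) (Z s))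
   ((dric_mean a1 a2 a3 (X t) (Y t) (Z t) dX dY dZ
     - dric_form a1 (X t) (Y t) (Z t) dX dY dZ) / (Y t * Z t)).
Proof.
move=> N0; apply: (@near_eq_is_derive _ _ _ (fun s =>
    (ric_mean a1 a2 a3 (X s) (Y s) (Z s) - ric_form a1 (X s) (Y s) (Z s))
    * (Y s * Z s)^-1)).
  by near=> s; rewrite f_ric_form ?gt_eqF //; near: s.
apply: (is_derive_quot0 (k := fun s => (Y s * Z s)^-1)) => //.
  have h1 := is_derive_ric_mean; have h2 := is_derive_ric_form hX hY hZ a1.
  exact: is_deriveB.
apply: derivableV; first by rewrite mulf_neq0 ?gt_eqF.
by apply: derivableM; [case: hY|case: hZ].
Unshelve. all: by end_near. Qed.

Lemma is_derive_g :
  ric_mean a1 a2 a3 (X t) (Y t) (Z t) - ric_form a2 (Y t) (X t) (Z t) = 0 ->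
  is_derive t 1 (fun s => g a1 a2 a3 (X s) (Y s) (Z s))
   ((dric_mean a1 a2 a3 (X t) (Y t) (Z t) dX dY dZ
     - dric_form a2 (Y t) (X t) (Z t) dY dX dZ) / (X t * Z t)).
Proof.
move=> N0; apply: (@near_eq_is_derive _ _ _ (fun s =>
    (ric_mean a1 a2 a3 (X s) (Y s) (Z s) - ric_form a2 (Y s) (X s) (Z s))
    * (X s * Z s)^-1)).
  by near=> s; rewrite g_ric_form ?gt_eqF //; near: s.
apply: (is_derive_quot0 (k := fun s => (X s * Z s)^-1)) => //.
  have h1 := is_derive_ric_mean; have h2 := is_derive_ric_form hY hX hZ a2.
  exact: is_deriveB.
apply: derivableV; first by rewrite mulf_neq0 ?gt_eqF.
by apply: derivableM; [case: hX|case: hZ].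
Unshelve. all: by end_near. Qed.

End FieldAlongCurve.

Lemma is_derive_phi1 a1 a2 a3 x1 x2 : 0 < x1 ->
  is_derive x1 1 (fun t => phi a1 a2 a3 t x2)
    (- (a3 / a1) * (phi a1 a2 a3 x1 x2 / x1)).
Proof.
move=> x10; have h := is_derive1_powR (- (a3 / a1)) x10.
have -> : (fun t => phi a1 a2 a3 t x2) =
  x2 `^ (- (a3 / a2)) \*: (fun t => t `^ (- (a3 / a1))).
  by apply/funext => t; rewrite /phi mulrC.
have e : x1 `^ (- (a3 / a1) - 1) = x1 `^ (- (a3 / a1)) / x1.
  by rewrite powRB ?powRr1 ?(ltW x10) // (gt_eqF x10) implybT.
by apply: is_derive_eq; rewrite e /phi /GRing.scale /=; ring.
Qed.

Lemma is_derive_phi2 a1 a2 a3 x1 x2 : 0 < x2 ->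
  is_derive x2 1 (fun t => phi a1 a2 a3 x1 t)
    (- (a3 / a2) * (phi a1 a2 a3 x1 x2 / x2)).
Proof.
move=> x20; have h := is_derive1_powR (- (a3 / a2)) x20.
have -> : (fun t => phi a1 a2 a3 x1 t) =
  x1 `^ (- (a3 / a1)) \*: (fun t => t `^ (- (a3 / a2))).
  by apply/funext => t; rewrite /phi.
have e : x2 `^ (- (a3 / a2) - 1) = x2 `^ (- (a3 / a2)) / x2.
  by rewrite powRB ?powRr1 ?(ltW x20) // (gt_eqF x20) implybT.
by apply: is_derive_eq; rewrite e /phi /GRing.scale /=; ring.
Qed.

(** The directions (1, 0, k1) and (0, 1, k2) are the tangent vectors of the
surface x_3 = phi. *)
Lemma J_singular a1 a2 a3 p : 0 < a1 -> 0 < a2 -> 0 < a3 ->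
  singular_point a1 a2 a3 p ->
  let x1 := p 0 0 in let x2 := p 0 1 in let x3 := phi a1 a2 a3 x1 x2 in
  let k1 := - (a3 / a1) * (x3 / x1) in let k2 := - (a3 / a2) * (x3 / x2) in
  let D d1 d2 d3 := dric_mean a1 a2 a3 x1 x2 x3 d1 d2 d3 in
  [/\ J a1 a2 a3 p 0 0 = (D 1 0 k1 - dric_form a1 x1 x2 x3 1 0 k1) / (x2 * x3),
      J a1 a2 a3 p 0 1 = (D 0 1 k2 - dric_form a1 x1 x2 x3 0 1 k2) / (x2 * x3),
      J a1 a2 a3 p 1 0 = (D 1 0 k1 - dric_form a2 x2 x1 x3 0 1 k1) / (x1 * x3) &
      J a1 a2 a3 p 1 1 = (D 0 1 k2 - dric_form a2 x2 x1 x3 1 0 k2) / (x1 * x3)].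
Proof.
move=> a10 a20 a30 [x10 x20 f0 g0] x1 x2 x3 k1 k2 D.
have x30 : 0 < x3 := phi_gt0 a1 a2 a3 x10 x20.
have dfield := differentiable_field a10 a20 a30 x10 x20.
have [e12 e23] := (singular_ric_form a10 a20 a30 (And4 x10 x20 f0 g0)).
have N2 : ric_mean a1 a2 a3 x1 x2 x3 - ric_form a2 x2 x1 x3 = 0.
  by rewrite (ric_mean_eq a10 a20 a30 e12 e23) subrr.
have N1 : ric_mean a1 a2 a3 x1 x2 x3 - ric_form a1 x1 x2 x3 = 0 by rewrite e12.
have fE : (fun y => field a1 a2 a3 y 0 0) =
  (fun y : 'rV[R]_2 => ftilde a1 a2 a3 (y 0 0) (y 0 1)).
  by apply/funext => y; rewrite /field (vec2E _ _).1.
have gE : (fun y => field a1 a2 a3 y 0 1) =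
  (fun y : 'rV[R]_2 => gtilde a1 a2 a3 (y 0 0) (y 0 1)).
  by apply/funext => y; rewrite /field (vec2E _ _).2.
have p1 := is_derive_phi1 a1 a2 a3 x2 x10.
have p2 := is_derive_phi2 a1 a2 a3 x1 x20.
have i1 : is_derive x1 1 id 1 by exact: is_derive_id.
have i2 : is_derive x2 1 id 1 by exact: is_derive_id.
have c1 : is_derive x2 1 (cst x1) 0 by exact: is_derive_cst.
have c2 : is_derive x1 1 (cst x2) 0 by exact: is_derive_cst.
rewrite !J_entry // fE gE !partial0 !partial1; split.
- by have [] := is_derive_f i1 c2 p1 x10 x20 x30 a10 a20 a30 N1.
- by have [] := is_derive_f c1 i2 p2 x10 x20 x30 a10 a20 a30 N1.
- by have [] := is_derive_g i1 c2 p1 x10 x20 x30 a10 a20 a30 N2.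
- by have [] := is_derive_g c1 i2 p2 x10 x20 x30 a10 a20 a30 N2.
Qed.
(** Linear algebra behind [delta_reduced_jac]: g_ij is the derivative of q_i in
x_j. By Euler's relation the differentials of q_1 - q_2 and q_2 - q_3 vanish on
(x_1, x_2, x_3), so all their minors are proportional: the minor along the
tangent plane of the surface is determined by the minor in (x_2, x_3). *)
Lemma weighted_minor (w1 w2 w3 x1 x2 x3 : R)
    (g11 g12 g13 g21 g22 g23 g31 g32 g33 : R) :
  w1 + w2 + w3 = 1 -> w3 != 0 -> x1 != 0 -> x2 != 0 -> x3 != 0 ->
  x1 * (g11 - g21) + x2 * (g12 - g22) + x3 * (g13 - g23) = 0 ->
  x1 * (g21 - g31) + x2 * (g22 - g32) + x3 * (g23 - g33) = 0 ->
  let k1 := - (w1 / w3) * (x3 / x1) in let k2 := - (w2 / w3) * (x3 / x2) in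
  let N1 d1 d2 d3 := w1 * (g11 * d1 + g12 * d2 + g13 * d3)
     + w2 * (g21 * d1 + g22 * d2 + g23 * d3)
     + w3 * (g31 * d1 + g32 * d2 + g33 * d3)
     - (g11 * d1 + g12 * d2 + g13 * d3) in
  let N2 d1 d2 d3 := w1 * (g11 * d1 + g12 * d2 + g13 * d3)
     + w2 * (g21 * d1 + g22 * d2 + g23 * d3)
     + w3 * (g31 * d1 + g32 * d2 + g33 * d3)
     - (g21 * d1 + g22 * d2 + g23 * d3) in
  2 * x1 * (N1 1 0 k1 * N2 0 1 k2 - N1 0 1 k2 * N2 1 0 k1) =
  x3 * ((2 * g12 - g22 - g32) * (g23 - g33) - (2 * g13 - g23 - g33) * (g22 - g32)).
Proof.
move=> w w30 x10 x20 x30 e2 e3.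
have g21E : g21 = g11 + (x2 * (g12 - g22) + x3 * (g13 - g23)) / x1.
  by apply: (mulfI x10); rewrite mulrDr mulrCA mulfV // mulr1; lra.
have g31E : g31 = g21 + (x2 * (g22 - g32) + x3 * (g23 - g33)) / x1.
  by apply: (mulfI x10); rewrite mulrDr mulrCA mulfV // mulr1; lra.
rewrite /= g31E g21E (_ : w1 = 1 - w2 - w3); last by lra.
by field; rewrite w30 x20 x10.
Qed.
Lemma det2 (T : comNzRingType) (A : 'M[T]_2) :
  \det A = A 0 0 * A 1 1 - A 0 1 * A 1 0.
Proof.
rewrite (expand_det_row _ 0) !big_ord_recl big_ord0 addr0 /cofactor !det_mx11 !mxE.
have -> : lift ord0 ord0 = 1 :> 'I_2 by exact: val_inj.
have -> : lift 1 0 = 0 :> 'I_2 by exact: val_inj.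
by rewrite /= expr0 expr1 mul1r mulN1r mulrN.
Qed.

(** The minor in (x_2, x_3) of the two conics is 2 x_1^2 times the Jacobian
determinant in (u, v), and the two factors 2 cancel. *)
Lemma delta_reduced_jac a1 a2 a3 p : 0 < a1 -> 0 < a2 -> 0 < a3 ->
  singular_point a1 a2 a3 p ->
  delta a1 a2 a3 p = reduced_jac a1 (a2 + a3) (a2 - a3) (ratios a1 a2 a3 p) /
    (p 0 1 * phi a1 a2 a3 (p 0 0) (p 0 1)).
Proof.
move=> a10 a20 a30 sing; have [x10 x20 _ _] := sing.
have [e12 e23] := singular_ric_form a10 a20 a30 sing.
have [J00 J01 J10 J11] := J_singular a10 a20 a30 sing.
rewrite /delta det2 J00 J01 J10 J11 /ratios.
have := phi_gt0 a1 a2 a3 x10 x20; move: e12 e23 {J00 J01 J10 J11}.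
move: (phi _ _ _ _ _) => x3; move: (p 0 0) (p 0 1) x10 x20 => x1 x2.
move=> x10 x20 e12 e23 x30.
have [x1n x2n x3n] : [/\ x1 != 0, x2 != 0 & x3 != 0] by rewrite !gt_eqF.
have [a1n a2n a3n] : [/\ a1 != 0, a2 != 0 & a3 != 0] by rewrite !gt_eqF.
set W := a1^-1 + a2^-1 + a3^-1.
have Wn : W != 0 by rewrite gt_eqF // !addr_gt0 ?invr_gt0.
pose w1 := a1^-1 / W; pose w2 := a2^-1 / W; pose w3 := a3^-1 / W.
have w1E : a3 / a1 = w1 / w3 by rewrite /w1 /w3; field; rewrite Wn a1n a3n.
have w2E : a3 / a2 = w2 / w3 by rewrite /w2 /w3; field; rewrite Wn a2n a3n.
have wS : w1 + w2 + w3 = 1 by rewrite /w1 /w2 /w3 -!mulrDl mulfV.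
have w3n : w3 != 0 by rewrite mulf_neq0 ?invr_eq0.
rewrite w1E w2E.
have eu1 : x1 * (2 * a1 * x1 - (x3 - 2 * a2 * x1)) + x2 * ((x3 - 2 * a1 * x2) -
  2 * a2 * x2) + x3 * ((x2 - 2 * a1 * x3) - (x1 - 2 * a2 * x3)) = 0.
  by move: e12; rewrite /ric_form; lra.
have eu2 : x1 * ((x3 - 2 * a2 * x1) - (x2 - 2 * a3 * x1)) + x2 * (2 * a2 * x2 -
  (x1 - 2 * a3 * x2)) + x3 * ((x1 - 2 * a2 * x3) - 2 * a3 * x3) = 0.
  by move: e23; rewrite /ric_form; lra.
have := weighted_minor wS w3n x1n x2n x3n eu1 eu2; cbv zeta.
set k1 := - _ * _; set k2 := - _ * _.
have DE d1 d2 d3 : dric_mean a1 a2 a3 x1 x2 x3 d1 d2 d3 =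
  w1 * (2 * a1 * x1 * d1 + (x3 - 2 * a1 * x2) * d2 + (x2 - 2 * a1 * x3) * d3) +
  w2 * ((x3 - 2 * a2 * x1) * d1 + 2 * a2 * x2 * d2 + (x1 - 2 * a2 * x3) * d3) +
  w3 * ((x2 - 2 * a3 * x1) * d1 + (x1 - 2 * a3 * x2) * d2 + 2 * a3 * x3 * d3).
  by rewrite /dric_mean -/W /dric_form /w1 /w2 /w3; ring.
have D1 d1 d2 d3 : dric_form a1 x1 x2 x3 d1 d2 d3 =
  2 * a1 * x1 * d1 + (x3 - 2 * a1 * x2) * d2 + (x2 - 2 * a1 * x3) * d3.
  by rewrite /dric_form; ring.
have D2 d1 d2 d3 : dric_form a2 x2 x1 x3 d2 d1 d3 =
  (x3 - 2 * a2 * x1) * d1 + 2 * a2 * x2 * d2 + (x1 - 2 * a2 * x3) * d3.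
  by rewrite /dric_form; ring.
rewrite -!DE -!D1 -!D2; set m := _ - _ => mE.
have -> : reduced_jac a1 (a2 + a3) (a2 - a3) ((x2 + x3) / x1, (x3 - x2) / x1) =
  ((2 * (x3 - 2 * a1 * x2) - 2 * a2 * x2 - (x1 - 2 * a3 * x2)) *
    (x1 - 2 * a2 * x3 - 2 * a3 * x3) -
   (2 * (x2 - 2 * a1 * x3) - (x1 - 2 * a2 * x3) - 2 * a3 * x3) *
    (2 * a2 * x2 - (x1 - 2 * a3 * x2))) / (2 * x1 ^+ 2).
  by rewrite /reduced_jac /=; field.
have x13 : 2 * x1 * x3 != 0 by rewrite !mulf_neq0 ?pnatr_eq0.
have -> (b1 b2 b3 b4 : R) : b1 / (x2 * x3) * (b2 / (x1 * x3)) -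
   b3 / (x2 * x3) * (b4 / (x1 * x3)) =
   (2 * x1 * (b1 * b2 - b3 * b4)) / (2 * x1 ^+ 2 * x2 * x3 ^+ 2).
  by field; rewrite x1n x2n x3n.
by rewrite -/m mE; field; rewrite x1n x2n x3n.
Qed.

(** The flow is x_i' = x_i (m - q_i) / (x_1 x_2 x_3). In the coordinates y_i =
ln x_i, a constant multiple S of the scalar curvature, restricted to the
surface, satisfies dS/dy_i = (q_3 - q_i) / (a_i x_1 x_2 x_3). At a singular
point its Hessian is the product G A, where A is the linearization of the flow
in the coordinates y_i and G has the entries 1 / a_i + a_3 / a_i^2 on the
diagonal and a_3 / (a_1 a_2) off it. The identity says that G A is symmetric. *)
Lemma J_symmetrizable a1 a2 a3 p : 0 < a1 -> 0 < a2 -> 0 < a3 ->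
  singular_point a1 a2 a3 p ->
  let x1 := p 0 0 in let x2 := p 0 1 in let M := J a1 a2 a3 p in
  (a1^-1 + a3 / a1 ^+ 2) * (M 0 1 * (x2 / x1)) + a3 / (a1 * a2) * M 1 1 =
  a3 / (a1 * a2) * M 0 0 + (a2^-1 + a3 / a2 ^+ 2) * (M 1 0 * (x1 / x2)).
Proof.
move=> a10 a20 a30 sing; have [x10 x20 _ _] := sing.
have [e12 e23] := singular_ric_form a10 a20 a30 sing.
have [J00 J01 J10 J11] := J_singular a10 a20 a30 sing.
cbv zeta; rewrite J00 J01 J10 J11.
have := phi_gt0 a1 a2 a3 x10 x20; move: e12 e23 {J00 J01 J10 J11}.
move: (phi _ _ _ _ _) => x3; move: (p 0 0) (p 0 1) x10 x20 => x1 x2.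
move=> x10 x20 e12 e23 x30.
have [x1n x2n x3n] : [/\ x1 != 0, x2 != 0 & x3 != 0] by rewrite !gt_eqF.
have [a1n a2n a3n] : [/\ a1 != 0, a2 != 0 & a3 != 0] by rewrite !gt_eqF.
have Wn : (a2 + a1) * a3 + a1 * a2 != 0.
  by rewrite gt_eqF // !(addr_gt0, mulr_gt0).
apply/eqP; rewrite -subr_eq0; apply/eqP.
transitivity (((a3 - a2) * ric_form a1 x1 x2 x3 + (a1 - a3) * ric_form a2 x2 x1 x3 +
  (a2 - a1) * ric_form a3 x3 x1 x2) / (a1 * a2 * x1 * x2 * x3)); last first.
  by rewrite e12 e23 -!mulrDl (_ : a3 - a2 + _ + _ = 0) ?mul0r //; ring.
by rewrite /dric_mean /dric_form /ric_form; field; rewrite Wn x1n x2n x3n a1n a2n a3n.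
Qed.
End Jacobian.

(** * Eigenvalues, and transport to the vector field *)

Section Types.
Variable R : realType.
Implicit Types (a x u v t : R) (p : 'rV[R]_2).

(** The two real roots of the characteristic polynomial, given by the quadratic
formula, are also all its complex roots. *)
Lemma real_eigenvalues2 (A : 'M[R]_2) :
  0 <= (A 0 0 - A 1 1) ^+ 2 + 4 * A 0 1 * A 1 0 ->
  exists l m, [/\ real_eigenvalues A l m, l <= m & l * m = \det A].
Proof.
set D := _ + _ => D0; pose w := Num.sqrt D.
have w2 : w ^+ 2 = D by rewrite sqr_sqrtr.
have w0 : 0 <= w by rewrite sqrtr_ge0.
pose l := (A 0 0 + A 1 1 - w) / 2; pose m := (A 0 0 + A 1 1 + w) / 2.
have lm : l * m = A 0 0 * A 1 1 - A 0 1 * A 1 0.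
  have -> : l * m = ((A 0 0 + A 1 1) ^+ 2 - w ^+ 2) / 4 by rewrite /l /m; field.
  by rewrite w2 /D; field.
have lDm : l + m = A 0 0 + A 1 1 by rewrite /l /m; field.
exists l, m; split; [|by rewrite /l /m; lra|by rewrite det2].
move=> z; rewrite eigenvalue_root_char rootE /char_poly det2.
have -> : (char_poly_mx (map_mx (real_complex R) A) 0 0 *
   char_poly_mx (map_mx (real_complex R) A) 1 1 -
   char_poly_mx (map_mx (real_complex R) A) 0 1 *
   char_poly_mx (map_mx (real_complex R) A) 1 0).[z] =
   (z - l%:C%C) * (z - m%:C%C).
  rewrite /char_poly_mx !mxE /= !hornerE /=.
  have e1 : (A 0 0)%:C%C + (A 1 1)%:C%C = l%:C%C + m%:C%C.
    by rewrite -!rmorphD lDm.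
  have e2 : (A 0 0)%:C%C * (A 1 1)%:C%C - (A 0 1)%:C%C * (A 1 0)%:C%C = l%:C%C * m%:C%C.
    by rewrite -!rmorphM -rmorphB lm.
  transitivity (z ^+ 2 - ((A 0 0)%:C%C + (A 1 1)%:C%C) * z +
    ((A 0 0)%:C%C * (A 1 1)%:C%C - (A 0 1)%:C%C * (A 1 0)%:C%C)); first by ring.
  by rewrite e1 e2; ring.
rewrite mulf_eq0 !subr_eq0; split=> [/orP[] /eqP|[] ->]; [by left|by right| |];
  by rewrite eqxx ?orbT.
Qed.

(** The symmetric matrix (g_ij) has nonnegative determinant, (m_ij) is the
matrix whose eigenvalues are studied, and the last hypothesis says that their
product is symmetric. If m12 m21 < 0, the discriminant times g12^2 is a square
plus 4 det(g) times - m12 m21. *)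
Lemma symmetrizable_disc (g11 g12 g22 m11 m12 m21 m22 : R) :
  0 < g12 -> g12 ^+ 2 <= g11 * g22 ->
  g11 * m12 + g12 * m22 = g12 * m11 + g22 * m21 ->
  0 <= (m11 - m22) ^+ 2 + 4 * m12 * m21.
Proof.
move=> g0 gd e.
have [h|h] := lerP 0 (m12 * m21).
  by rewrite addr_ge0 ?sqr_ge0 // -mulrA mulr_ge0.
rewrite -(@pmulr_rge0 _ (g12 ^+ 2)) ?exprn_gt0 //.
have -> : g12 ^+ 2 * ((m11 - m22) ^+ 2 + 4 * m12 * m21) =
  (g12 * m11 - g12 * m22) ^+ 2 + 4 * g12 ^+ 2 * (m12 * m21) by ring.
have -> : g12 * m11 = g11 * m12 + g12 * m22 - g22 * m21 by lra.
have -> : (g11 * m12 + g12 * m22 - g22 * m21 - g12 * m22) ^+ 2 +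
   4 * g12 ^+ 2 * (m12 * m21) = (g11 * m12 + g22 * m21) ^+ 2 +
   4 * ((g11 * g22 - g12 ^+ 2) * - (m12 * m21)) by ring.
by rewrite addr_ge0 ?sqr_ge0 // mulr_ge0 // mulr_ge0 ?subr_ge0 // oppr_ge0 ltW.
Qed.

Lemma singular_node a1 a2 a3 p : 0 < a1 -> 0 < a2 -> 0 < a3 ->
  singular_point a1 a2 a3 p -> 0 < delta a1 a2 a3 p -> node a1 a2 a3 p.
Proof.
move=> a10 a20 a30 sing d0; have [x10 x20 _ _] := sing.
have := J_symmetrizable a10 a20 a30 sing; rewrite /= => sy.
have [|l [m [ev lm e]]] := @real_eigenvalues2 (J a1 a2 a3 p).
  have -> : 4 * J a1 a2 a3 p 0 1 * J a1 a2 a3 p 1 0 =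
    4 * (J a1 a2 a3 p 0 1 * (p 0 1 / p 0 0)) *
        (J a1 a2 a3 p 1 0 * (p 0 0 / p 0 1)).
    by field; rewrite !gt_eqF.
  apply: symmetrizable_disc sy; first by rewrite divr_gt0 ?mulr_gt0.
  rewrite -subr_ge0 (_ : _ - _ = (a1 * a2)^-1 + a3 * (a1 ^- 2 / a2 + a2 ^- 2 / a1)).
    by rewrite addr_ge0 ?mulr_ge0 ?addr_ge0 ?divr_ge0 ?invr_ge0 ?mulr_ge0 ?exprn_ge0 //
      ltW.
  by field; rewrite !gt_eqF.
split=> //; exists l, m; split=> //; move: d0; rewrite /delta -e => lm0.
have [l0|l0|l0] := ltgtP l 0.
- by right; split=> //; move: lm0; rewrite nmulr_rgt0.
- by left; split=> //; move: lm0; rewrite pmulr_rgt0.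
- by move: lm0; rewrite l0 mul0r ltxx.
Qed.

Lemma singular_saddle a1 a2 a3 p :
  singular_point a1 a2 a3 p -> delta a1 a2 a3 p < 0 -> saddle a1 a2 a3 p.
Proof.
move=> sing d0; have [|l [m [ev lm e]]] := @real_eigenvalues2 (J a1 a2 a3 p).
  rewrite (_ : _ + _ = (J a1 a2 a3 p 0 0 + J a1 a2 a3 p 1 1) ^+ 2 +
    4 * - delta a1 a2 a3 p); last by rewrite /delta det2; ring.
  by rewrite addr_ge0 ?sqr_ge0 // mulr_ge0 // oppr_ge0 ltW.
split=> //; exists l, m; split=> //; move: d0; rewrite /delta -e => lm0.
have l0 : l < 0.
  rewrite ltNge; apply/negP => l0; move: lm0; rewrite ltNge => /negP; apply.
  by rewrite mulr_ge0 // (le_trans l0).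
by rewrite l0 /=; move: lm0; rewrite nmulr_rlt0.
Qed.

Section Transport.
Variables a1 a2 a3 : R.
Hypotheses (h1 : 0 < a1 < 1 / 2) (h2 : 0 < a2 < 1 / 2) (h3 : 0 < a3 < 1 / 2).
Let a10 : 0 < a1. Proof. by case/andP: h1. Qed.
Let a20 : 0 < a2. Proof. by case/andP: h2. Qed.
Let a30 : 0 < a3. Proof. by case/andP: h3. Qed.
Let C := reduced a1 (a2 + a3) (a2 - a3).
Let k := reduced_jac a1 (a2 + a3) (a2 - a3).
Let P := of_ratios a1 a2 a3.

Lemma reduced_ratiosK z : C z ->
  [/\ 0 < P z 0 0, 0 < P z 0 1 & ratios a1 a2 a3 (P z) = z].
Proof.
case: z => u v Cz; have [] := reduced_pos h1 h2 h3 Cz.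
exact: (@ratiosK _ a1 a2 a3 (u, v)).
Qed.

Lemma reduced_singular z : C z -> singular_point a1 a2 a3 (P z).
Proof.
by move=> Cz; have [x10 x20 e] := reduced_ratiosK Cz; apply/singular_ratios; rewrite // e.
Qed.

Lemma reduced_delta z : C z -> Num.sg (delta a1 a2 a3 (P z)) = Num.sg (k z).
Proof.
move=> Cz; have [x10 x20 e] := reduced_ratiosK Cz.
have x30 := phi_gt0 a1 a2 a3 x10 x20.
rewrite delta_reduced_jac ?e //; last exact: reduced_singular.
by rewrite sgrM (gtr0_sg (x := _^-1)) ?mulr1 // invr_gt0 mulr_gt0.
Qed.

(** The map from solutions to singular points is injective, because taking
ratios is a left inverse, and surjective, because it is also a right inverse. *)
Lemma reduced_points zs : (forall z, C z <-> z \in zs) -> uniq zs ->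
  uniq (map P zs) /\ singular_point a1 a2 a3 = [set` map P zs].
Proof.
move=> CE Un; split.
  rewrite map_inj_in_uniq // => z z' /CE Cz /CE Cz' e.
  have [_ _ <-] := reduced_ratiosK Cz; have [_ _ <-] := reduced_ratiosK Cz'.
  by rewrite e.
apply/seteqP; split=> p /=.
  move=> sp; have [x10 x20 Cz] := (singular_ratios p a10 a20 a30).1 sp.
  by rewrite -(of_ratiosK a10 a20 a30 x10 x20); apply/map_f/CE.
by move=> /mapP[z /CE Cz ->]; exact: reduced_singular.
Qed.

Lemma reduced_saddle z : C z -> k z < 0 ->
  delta a1 a2 a3 (P z) < 0 /\ saddle a1 a2 a3 (P z).
Proof.
move=> Cz kz; have d0 : delta a1 a2 a3 (P z) < 0.
  by rewrite -sgr_cp0 reduced_delta // sgr_cp0.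
by split=> //; apply: singular_saddle => //; exact: reduced_singular.
Qed.

Lemma reduced_node z : C z -> 0 < k z ->
  0 < delta a1 a2 a3 (P z) /\ node a1 a2 a3 (P z).
Proof.
move=> Cz kz; have d0 : 0 < delta a1 a2 a3 (P z).
  by rewrite -sgr_cp0 reduced_delta // sgr_cp0.
by split=> //; apply: singular_node => //; exact: reduced_singular.
Qed.

Lemma reduced_one_node_three_saddles :
  one_pos_three_neg C k -> one_node_three_saddles a1 a2 a3.
Proof.
move=> [z0 [z1 [z2 [z3 [Un CE k0 k123]]]]].
have [UP SP] := reduced_points CE Un.
exists (P z0), (P z1), (P z2), (P z3); split=> //.
  by apply: reduced_node => //; apply/CE; rewrite mem_head.
move=> y; rewrite -/(map P [:: z1; z2; z3]) => /mapP[z z123 ->].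
by apply: reduced_saddle (k123 _ z123); apply/CE; rewrite inE z123 orbT.
Qed.

Lemma reduced_two_saddles : two_neg C k -> two_saddles a1 a2 a3.
Proof.
move=> [z1 [z2 [Un CE k12]]]; have [UP SP] := reduced_points CE Un.
exists (P z1), (P z2); split=> //.
move=> y; rewrite -/(map P [:: z1; z2]) => /mapP[z z12 ->].
by apply: reduced_saddle (k12 _ z12); apply/CE.
Qed.
End Transport.

End Types.

(** * The sign of Q on connected components *)

Section Components.
Variable R : realType.

Section ContinuousAt.
Variables (T : topologicalType) (x : T).
Implicit Types h k : T -> R.
(** Pointwise forms of the closure rules, matching the syntax of Qpoly. *)
Lemma continuous_at_add h k : continuous_at x h -> continuous_at x k ->
  continuous_at x (fun y => h y + k y).
Proof. exact: continuousD. Qed.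
Lemma continuous_at_mul h k : continuous_at x h -> continuous_at x k ->
  continuous_at x (fun y => h y * k y).
Proof. exact: continuousM. Qed.
Lemma continuous_at_opp h : continuous_at x h -> continuous_at x (fun y => - h y).
Proof. exact: continuousN. Qed.
Lemma continuous_at_exp h n : continuous_at x h -> continuous_at x (fun y => h y ^+ n).
Proof.
move=> hc; elim: n => [|n IH].
  under [X in continuous_at x X]eq_fun do rewrite expr0.
  exact: cst_continuous.
under [X in continuous_at x X]eq_fun do rewrite exprS.
exact: continuous_at_mul.
Qed.
End ContinuousAt.

Lemma continuous_Qpoly :
  continuous (fun a : 'rV[R]_3 => Qpoly (a 0 0) (a 0 1) (a 0 2)).
Proof.
move=> a; have c i : continuous_at a (fun b : 'rV[R]_3 => b 0 i).
  exact: coord_continuous.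
have c0 := c 0; have c1 := c 1; have c2 := c 2.
rewrite /Qpoly /=.
repeat lazymatch goal with
  | |- continuous_at _ (fun _ => ?c) => exact: cst_continuous
  | |- continuous_at _ (fun y => _ + _) => apply: continuous_at_add
  | |- continuous_at _ (fun y => - _) => apply: continuous_at_opp
  | |- continuous_at _ (fun y => _ * _) => apply: continuous_at_mul
  | |- continuous_at _ (fun y => _ ^+ _) => apply: continuous_at_exp
  | _ => first [exact: c0 | exact: c1 | exact: c2]
  end.
Qed.

(** The image of a connected set on which Q has no zero is an interval that does
not contain 0. *)
Lemma component_Qpoly_sign (p a : 'rV[R]_3) :
  let Q (a : 'rV[R]_3) := Qpoly (a 0 0) (a 0 1) (a 0 2) in
  connected_component (open_cube `\` Omega) p a ->
  (forall i, 0 < a 0 i < 1 / 2) /\ ((Q p < 0 -> Q a < 0) /\ (0 < Q p -> 0 < Q a)).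
Proof.
move=> Q [C [Cp CU conC] Ca]; split; first by have [] := CU _ Ca.
have QC0 b : C b -> Q b != 0 by move=> /CU[_ Qb]; apply/eqP.
have : connected (Q @` C).
  by apply: connected_continuous_connected conC _; apply: continuous_subspaceT;
    exact: continuous_Qpoly.
move=> /connected_intervalP itv.
have Qa : (Q @` C) (Q a) by exists a.
have Qp : (Q @` C) (Q p) by exists p.
have n0 : ~ (Q @` C) 0 by move=> [b /QC0/eqP].
split=> Q0; rewrite ltNge; apply/negP => Q1; apply: n0.
  by apply: (itv _ _ Qp Qa); rewrite (ltW Q0).
by apply: (itv _ _ Qa Qp); rewrite (ltW Q0) Q1.
Qed.
End Components.

Theorem theorem6 (R : realType) (a1 a2 a3 : R) :
  (O1 (vec3 a1 a2 a3) \/ O2 (vec3 a1 a2 a3) ->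
     one_node_three_saddles a1 a2 a3) /\
  (O3 (vec3 a1 a2 a3) -> two_saddles a1 a2 a3).
Proof.
have v3 (x y z : R) : [/\ vec3 x y z 0 0 = x, vec3 x y z 0 1 = y &
    vec3 x y z 0 2 = z] by rewrite /vec3 !mxE.
have [v0 v1 v2] := v3 a1 a2 a3.
have sign (p1 p2 p3 : R) :
    connected_component (open_cube `\` Omega) (vec3 p1 p2 p3) (vec3 a1 a2 a3) ->
    [/\ 0 < a1 < 1 / 2, 0 < a2 < 1 / 2 & 0 < a3 < 1 / 2] /\
    ((Qpoly p1 p2 p3 < 0 -> Qpoly a1 a2 a3 < 0) /\
     (0 < Qpoly p1 p2 p3 -> 0 < Qpoly a1 a2 a3)).
  move=> /component_Qpoly_sign[cube]; have [-> -> ->] := v3 p1 p2 p3.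
  rewrite v0 v1 v2 => Q; split=> //.
  by split; [have := cube 0|have := cube 1|have := cube 2];
    rewrite ?v0 ?v1 ?v2.
have neg : [/\ 0 < a1 < 1 / 2, 0 < a2 < 1 / 2 & 0 < a3 < 1 / 2] ->
    Qpoly a1 a2 a3 < 0 -> one_node_three_saddles a1 a2 a3.
  move=> [h1 h2 h3] /(reduced_classification h1 h2 h3).1.
  exact: reduced_one_node_three_saddles.
split=> [[/sign[cube [Qneg _]]|/sign[cube [Qneg _]]]|/sign[[h1 h2 h3] [_ Qpos]]].
- by apply: neg (Qneg _) => //; rewrite /Qpoly; lra.
- by apply: neg (Qneg _) => //; rewrite /Qpoly; lra.
- apply: reduced_two_saddles => //.
  by apply: (reduced_classification h1 h2 h3).2; apply: Qpos; rewrite /Qpoly; lra.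
Qed.
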